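(* For each $n\in\mathbb{N}$ let $X^{(n)},Y^{(n)}$ be independent random vectors in $\mathbb{R}^n$ such that either (for all $n$) both are uniformly distributed on $\partial B_\infty^n$ with respect to the cone measure, or (for all $n$) both are uniformly distributed on $B_\infty^n$. Then, as $n\to\infty$, $$\sqrt{n}\left(n^{-1/2}\,\Vert X^{(n)}-Y^{(n)}\Vert_2-\sqrt{\frac{2}{3}}\right)\overset{d}{\longrightarrow}N\left(0,\frac{7}{30}\right).$$
   Context: For $x\in\mathbb{R}^n$, $\Vert x\Vert_\infty=\max_{1\le i\le n}|x_i|$ and $\Vert x\Vert_2$ is the Euclidean norm. $B_\infty^n=\{x\in\mathbb{R}^n:\Vert x\Vert_\infty\le 1\}=[-1,1]^n$ and $\partial B_\infty^n$ is its boundary. The cone probability measure on $\partial B_\infty^n$ is $\mu_\infty^n(A)=\mathrm{Vol}(\{ta: a\in A,\ 0\le t\le 1\})/\mathrm{Vol}(B_\infty^n)$ for Borel $A\subset\partial B_\infty^n$, where $\mathrm{Vol}$ is Lebesgue measure. $\overset{d}{\longrightarrow}$ denotes convergence in distribution, and $N(0,\sigma^2)$ is the centered Gaussian distribution with variance $\sigma^2$. *)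

(* Defs.v *)
From HB Require Import structures.
From mathcomp Require Import all_boot all_order all_algebra.
From mathcomp Require Import all_classical all_reals all_analysis.
From mathcomp Require Import measurable_realfun.

Set Implicit Arguments.
Unset Strict Implicit.
Unset Printing Implicit Defensive.

Import Order.TTheory GRing.Theory Num.Theory.
Import numFieldNormedType.Exports.

Local Open Scope classical_set_scope.
Local Open Scope ring_scope.

(* Row vectors 'rV[R]_n, with the topology of the maximum norm, represent R^n;
   matrices carry their Borel sigma-algebra. *)
Definition mx_open (R : realType) (m n : nat) : set (set 'M[R]_(m, n)) := open.

HB.instance Definition _ (R : realType) (m n : nat) :=
  @isMeasurable.Build (sigma_display (@mx_open R m n)) 'M[R]_(m, n)
    <<s @mx_open R m n >>
    (@sigma_algebra0 _ setT (@mx_open R m n))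
    (@sigma_algebraC _ (@mx_open R m n))
    (@sigma_algebra_bigcup _ setT (@mx_open R m n)).

Section measurability.
Variable R : realType.

Lemma open_measurable_mx m n (U : set 'M[R]_(m, n)) : open U -> measurable U.
Proof. exact: sub_sigma_algebra. Qed.

Lemma continuous_measurable_mx m n (f : 'M[R]_(m, n) -> R) :
  continuous f -> measurable_fun [set: 'M[R]_(m, n)] f.
Proof.
move=> /continuousP cf; apply: (measurability _ (RGenOpens.measurableE R)).
move=> _ [_ [a [b ->]] <-]; rewrite setTI; apply: open_measurable_mx.
exact/cf/interval_open.
Qed.

Lemma measurable_coord_mx m n i j :
  measurable_fun [set: 'M[R]_(m, n)] (fun M => M i j).
Proof. by apply: continuous_measurable_mx; exact: coord_continuous. Qed.

Lemma measurable_fun_mx d (T : measurableType d) m n (f : T -> 'M[R]_(m, n)) :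
  (forall i j, measurable_fun setT (fun t => f t i j)) ->
  measurable_fun [set: T] f.
Proof.
move=> mf; apply: (@measurability _ _ _ _ _ _ (@mx_open R m n) erefl).
move=> _ [U oU <-]; rewrite setTI.
pose B (qk : 'M[rat]_(m, n) * nat) : set 'M[R]_(m, n) :=
  [set x | forall i j, `|ratr (qk.1 i j) - x i j| < qk.2.+1%:R^-1].
have -> : U = \bigcup_(qk in [set qk | B qk `<=` U]) B qk.
  apply/seteqP; split => [x Ux|x [qk /= BU]]; last exact: BU.
  have /nbhs_ballP[e /= e0 xeU] : nbhs x U by exact: open_nbhs_nbhs.
  have [k ke] : exists k : nat, k.+1%:R^-1 < e / 2.
    have [k] := ltr_add_invr (divr_gt0 e0 (ltr0n R 2)).
    by rewrite add0r => ?; exists k.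
  have k0 : 0 < k.+1%:R^-1 :> R by rewrite invr_gt0.
  have qx (ij : 'I_m * 'I_n) :
      exists q : rat, `|ratr q - x ij.1 ij.2| < k.+1%:R^-1 :> R.
    have [|q] := @rat_in_itvoo R (x ij.1 ij.2 - k.+1%:R^-1)
                                 (x ij.1 ij.2 + k.+1%:R^-1).
      by rewrite ltrD2l (lt_trans _ k0)// oppr_lt0.
    rewrite in_itv/= => /andP[q1 q2]; exists q.
    by rewrite ltr_norml ltrBDr ltrBlDr addrC q1 addrC.
  have [q qP] := choice qx.
  exists (\matrix_(i, j) q (i, j), k).
    move=> y By; apply: xeU; split => // i j.
    have := By i j; have := qP (i, j); rewrite !mxE /= => qx1 qy1.
    rewrite /ball/= -(subrKA (ratr (q (i, j)))) (le_lt_trans (ler_normD _ _))//.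
    by rewrite (splitr e) ltrD// (lt_trans _ ke)// distrC.
  by move=> i j; rewrite mxE; exact: (qP (i, j)).
rewrite preimage_bigcup bigcup_mkcond; apply: countable_bigcupT_measurable => //.
move=> qk; case: ifPn => // _.
have -> : f @^-1` B qk =
    \big[setI/setT]_(ij : 'I_m * 'I_n)
      ((fun t => f t ij.1 ij.2) @^-1`
        ball (ratr (qk.1 ij.1 ij.2) : R) qk.2.+1%:R^-1).
  rewrite -classical_sets.bigcap_seq; apply/seteqP; split => t /= Bt.
    by move=> ij _; exact: Bt.
  by move=> i j; apply: (Bt (i, j)); rewrite /= mem_index_enum.
apply: bigsetI_measurable => ij _; rewrite -[X in measurable X]setTI.
by apply: mf => //; exact: measurable_ball.
Qed.

End measurability.

Section lebesgue_rV.
Variable R : realType.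

Definition cons_rV n (p : R * 'rV[R]_n) : 'rV[R]_n.+1 :=
  row_mx (p.1%:M : 'rV[R]_1) p.2.

Definition uncons_rV n (x : 'rV[R]_n.+1) : R * 'rV[R]_n :=
  (x 0 0, rsubmx (x : 'rV[R]_(1 + n))).

Lemma cons_rVK n : cancel (@cons_rV n) (@uncons_rV n).
Proof.
move=> [a x]; rewrite /uncons_rV /cons_rV/= row_mxKr; congr pair.
transitivity (row_mx (scalar_mx a : 'rV_1) x ord0 (lshift n ord0)).
  by congr (row_mx _ _ _ _); exact: val_inj.
by rewrite row_mxEl mxE eqxx.
Qed.

Lemma measurable_cons_rV n : measurable_fun setT (@cons_rV n).
Proof.
apply: measurable_fun_mx => i j; rewrite /cons_rV.
have [k ->|k ->] := split_ordP (j : 'I_(1 + n)).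
- rewrite (_ : (fun t => _) = fst); first exact: measurable_fst.
  apply/funext => p; apply: etrans (row_mxEl _ _ _ _) _.
  by rewrite mxE !ord1 eqxx.
- rewrite (_ : (fun t => _) = (fun M : 'rV[R]_n => M i k) \o snd).
    exact: (measurableT_comp (measurable_coord_mx i k) measurable_snd).
  by apply/funext => p; exact: row_mxEr.
Qed.

Lemma measurable_uncons_rV n : measurable_fun setT (@uncons_rV n).
Proof.
apply/measurable_fun_pairP; split => /=; first exact: measurable_coord_mx.
apply: measurable_fun_mx => i j /=.
under eq_fun do rewrite mxE.
exact: measurable_coord_mx.
Qed.

Section step.
Variables (n : nat) (mu : {sigma_finite_measure set 'rV[R]_n -> \bar R}).

Definition lebesgue_rV_step : set 'rV[R]_n.+1 -> \bar R :=
  pushforward (@lebesgue_measure R \x mu)%E (@cons_rV n).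

Let step0 : lebesgue_rV_step set0 = 0%E.
Proof. by rewrite /lebesgue_rV_step /pushforward preimage_set0 measure0. Qed.

Let step_ge0 A : (0 <= lebesgue_rV_step A)%E.
Proof. exact: (measure_ge0 (@lebesgue_measure R \x mu)%E). Qed.

Let step_sigma_additive : semi_sigma_additive lebesgue_rV_step.
Proof.
move=> F mF tF mUF; rewrite /lebesgue_rV_step /pushforward preimage_bigcup.
have mpre A : measurable A -> measurable (@cons_rV n @^-1` A).
  by move=> mA; rewrite -[X in measurable X]setTI; exact: measurable_cons_rV.
apply: (@measure_semi_sigma_additive _ _ _ (@lebesgue_measure R \x mu)%E
  (fun k => @cons_rV n @^-1` F k)).
- by move=> k; exact: mpre.
- apply/trivIsetP => /= i j _ _ ij; rewrite -preimage_setI.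
  by move/trivIsetP : tF => /(_ _ _ _ _ ij) ->//; rewrite preimage_set0.
- by rewrite -preimage_bigcup; exact: mpre.
Qed.

HB.instance Definition _ := isMeasure.Build _ _ _ lebesgue_rV_step
  step0 step_ge0 step_sigma_additive.

Let sigma_finite_step : sigma_finite setT lebesgue_rV_step.
Proof.
have /sigma_finiteP[F [TF ndF Foo]] := sigma_finiteT (@lebesgue_measure R).
have /sigma_finiteP[G [TG ndG Goo]] := sigma_finiteT mu.
exists (fun k => @uncons_rV n @^-1` (F k `*` G k)).
  apply/seteqP; split => // x _.
  have [i _ Fi] : (\bigcup_i F i) (uncons_rV x).1 by rewrite -TF.
  have [j _ Gj] : (\bigcup_i G i) (uncons_rV x).2 by rewrite -TG.
  exists (maxn i j) => //; split.
  - by move: Fi; exact/subsetPset/ndF/leq_maxl.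
  - by move: Gj; exact/subsetPset/ndG/leq_maxr.
move=> k; have [mF Fk] := Foo k; have [mG Gk] := Goo k; split.
  rewrite -[X in measurable X]setTI; apply: measurable_uncons_rV => //.
  exact: measurableX.
rewrite /lebesgue_rV_step /pushforward.
rewrite (_ : _ @^-1` _ = F k `*` G k); last first.
  by apply/seteqP; split => p; rewrite /preimage /mkset cons_rVK.
by rewrite product_measure1E// lte_mul_pinfty// ge0_fin_numE.
Qed.

HB.instance Definition _ :=
  Measure_isSigmaFinite.Build _ _ _ lebesgue_rV_step sigma_finite_step.

End step.

(* n-dimensional Lebesgue measure: the n-fold product of the Lebesgue measure
   on R, transported to row vectors; on the one-point space 'rV[R]_0 it is the
   unit mass. *)
Fixpoint lebesgue_rV n : {sigma_finite_measure set 'rV[R]_n -> \bar R} :=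
  if n is n'.+1 then lebesgue_rV_step (lebesgue_rV n') else \d_(0 : 'rV[R]_0).

End lebesgue_rV.
Arguments lebesgue_rV : clear implicits.

Section cube.
Variables (R : realType) (n : nat).

(* The norm `|x| of x : 'rV[R]_n is the maximum norm, see [mx_norm]. *)
Definition cube : set 'rV[R]_n := [set x | `|x| <= 1].

Definition norm2 (x : 'rV[R]_n) : R := Num.sqrt (\sum_(i < n) x ord0 i ^+ 2).

Definition topological_boundary (A : set 'rV[R]_n) : set 'rV[R]_n :=
  closure A `\` interior A.

Definition cube_boundary : set 'rV[R]_n := topological_boundary cube.

Definition cone (A : set 'rV[R]_n) : set 'rV[R]_n :=
  [set x | exists a t, [/\ A a, 0 <= t <= 1 & x = t *: a]].

(* Meaningful for A `<=` cube_boundary. *)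
Definition cone_measure (A : set 'rV[R]_n) : \bar R :=
  (lebesgue_rV R n (cone A) / lebesgue_rV R n cube)%E.

End cube.
Arguments cube {R n}.
Arguments cube_boundary {R n}.

Section random_vectors.
Variables (R : realType) (d : measure_display) (T : measurableType d).
Variable P : probability T R.

Definition uniform_on_cube n (X : {RV P >-> 'rV[R]_n}) :=
  forall A : set 'rV[R]_n, measurable A ->
    distribution P X A = (lebesgue_rV R n (A `&` cube) / lebesgue_rV R n cube)%E.

Definition uniform_on_cube_boundary n (X : {RV P >-> 'rV[R]_n}) :=
  forall A : set 'rV[R]_n, measurable A ->
    distribution P X A = cone_measure (A `&` cube_boundary).

Definition independent_RV d1 d2 (T1 : measurableType d1)
    (T2 : measurableType d2) (X : {RV P >-> T1}) (Y : {RV P >-> T2}) :=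
  forall (A : set T1) (B : set T2), measurable A -> measurable B ->
    P (X @^-1` A `&` Y @^-1` B) = (P (X @^-1` A) * P (Y @^-1` B))%E.

End random_vectors.

(* Convergence of distribution functions at every continuity point of the
   limiting one; the Z n may live on different probability spaces. *)
Definition cvg_in_distribution (R : realType) (d : nat -> measure_display)
    (T : forall n, measurableType (d n)) (P : forall n, probability (T n) R)
    (Z : forall n, T n -> R) (nu : set R -> \bar R) :=
  forall x : R, {for x, continuous (fun y : R => nu `]-oo, y]%classic)} ->
    P n [set w | Z n w <= x] @[n --> \oo] --> nu `]-oo, x]%classic.

(* Main.v *)
Require Import Defs.
From HB Require Import structures.
From mathcomp Require Import all_boot all_order all_algebra.
From mathcomp Require Import all_classical all_reals all_analysis.
From mathcomp Require Import measurable_realfun ring lra.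

Set Implicit Arguments.
Unset Strict Implicit.
Unset Printing Implicit Defensive.

Import Order.TTheory GRing.Theory Num.Theory.
Import numFieldNormedType.Exports.

Local Open Scope classical_set_scope.
Local Open Scope ring_scope.

(** For n > 0 the variable of the theorem is Z = |X - Y|_2 - sqrt (2 n / 3). If X
and Y are uniform in the cube, then |X - Y|_2^2 is a sum of n independent copies
of (a - b)^2, with a and b uniform in [-1, 1] ([sqdist_law]); this variable has
mean 2/3 and variance 16/15 - 4/9 = 28/45. By the central limit theorem,
W = (|X - Y|_2^2 - 2 n / 3) / sqrt n is asymptotically N(0, 28/45)
([deviation_cvg]). Squaring shows that the event Z <= x is exactly
W <= 2 sqrt (2/3) x + x^2 / sqrt n as soon as n is large ([norm2_deviation]), and
dividing by 2 sqrt (2/3) turns the variance 28/45 into 7/30.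

The central limit theorem ([central_limit]) is proved by Lindeberg's replacement
method, with test functions for which the Gaussian side is explicit. Let Phi be
the standard Gaussian distribution function. Then u(s, x) = Phi(x / sqrt s) solves
the heat equation, so that, up to an error of order n^(-3/2), averaging
u(s, .) over one more summand of variance v / n has the effect of replacing s by
s + v / n ([shift_average_smoothed]). After n steps, u(eps, .) has become
u(eps + v, .) with an error of order n^(-1/2), and u(eps, .) is close to the
indicator of a half-line if eps is small.

If X and Y follow the cone measure, they are distributed like X' / |X'| and
Y' / |Y'| with X' and Y' uniform in the cube and |.| the maximum norm
([cone_measureE]). As 1 - |X'| is of order 1 / n, the normalisation changes the
squared distance by O(1) in probability, hence W by an amount that tends to 0
([normalize_pair_far]), and the limit is the same ([slutsky]). *)

(** The product rule, with a derivative written in terms of the product of R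
instead of the scaling of R as a module over itself. *)
Lemma is_derive_mul (R : realType) (f g : R -> R) (x a b : R) :
  is_derive x (1 : R) f a -> is_derive x (1 : R) g b ->
  is_derive x (1 : R) (fun z => f z * g z) (a * g x + f x * b).
Proof.
move=> df dg; apply: trigger_derive (is_deriveM df dg) _.
by rewrite addrC [in RHS]mulrC.
Qed.

(** * The Gaussian distribution function *)

Section gaussian_cdf.
Variable R : realType.
Implicit Types x y s : R.

Definition Gpdf : R -> R := normal_pdf 0 1.

Definition Gcdf x : R := fine (normal_prob 0 1 `]-oo, x]%classic).

Lemma GcdfE x : normal_prob 0 1 `]-oo, x]%classic = (Gcdf x)%:E.
Proof. by rewrite /Gcdf fineK// fin_num_measure. Qed.

Lemma Gcdf_ge0 x : 0 <= Gcdf x.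
Proof. by rewrite -lee_fin -GcdfE. Qed.

Lemma Gcdf_le1 x : Gcdf x <= 1.
Proof. by rewrite -lee_fin -GcdfE probability_le1. Qed.

Lemma GpdfE x : Gpdf x = normal_peak 1 * expR (- (x ^+ 2) / 2).
Proof.
by rewrite /Gpdf normal_pdfE ?oner_neq0// /normal_fun subr0 expr1n.
Qed.

Lemma Gpdf_ge0 x : 0 <= Gpdf x.
Proof. exact: normal_pdf_ge0. Qed.

Lemma is_derive_Gcdf x : is_derive x 1 Gcdf (Gpdf x).
Proof.
have xx1 : x < x + 1 by rewrite ltrDl.
have [|//||dF F'] := @continuous_FTC1 R Gpdf -oo%O x (x + 1) xx1.
- exact: integrableS (integrable_normal_pdf 0 1).
- exact: ltNyr.
- exact: (@continuous_normal_pdf R 0 1 (oner_neq0 _) x).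
by rewrite derive1E in F'; rewrite -F'; exact: derivableP.
Qed.

Lemma is_derive_Gpdf x : is_derive x 1 Gpdf (- x * Gpdf x).
Proof.
rewrite [X in is_derive _ _ X _](_ : _ =
    (fun z => normal_peak 1 * expR (z * z * - 2^-1))); last first.
  by apply/funext => z; rewrite GpdfE expr2 mulNr mulrN.
have D1 := is_derive_mul (is_derive_id x 1) (is_derive_id x 1).
have D2 := is_derive_mul D1 (is_derive_cst (- 2^-1 : R) x 1).
have D3 := is_derive1_comp (is_derive_expR _) D2.
have := is_derive_mul (is_derive_cst (normal_peak 1 : R) x 1) D3.
move=> /trigger_derive; apply.
by rewrite GpdfE /= /cst /idfun expr2 (_ : - (x * x) / 2 = x * x * - 2^-1); field.
Qed.

(** The first two derivatives of the Gaussian density. *)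
Definition dGpdf x : R := - x * Gpdf x.
Definition d2Gpdf x : R := (x ^+ 2 - 1) * Gpdf x.

Lemma is_derive_dGpdf x : is_derive x 1 dGpdf (d2Gpdf x).
Proof.
have := is_derive_mul (is_deriveN (is_derive_id x 1)) (is_derive_Gpdf x).
by move=> /trigger_derive; apply; rewrite /d2Gpdf !fctE; ring.
Qed.

(* [Gcdf] is the distribution function of the identity, as a random variable on
   the line endowed with the Gaussian measure. *)
Let idR : measurableTypeR R -> R := idfun.

#[local] HB.instance Definition _ :=
  @isMeasurableFun.Build _ _ _ _ idR (@measurable_id _ _ setT).

Let cdf_idR x : cdf (idR : {RV (normal_prob 0 1) >-> R}) x = (Gcdf x)%:E.
Proof. by rewrite -GcdfE. Qed.

Lemma cvg_Gcdfy : Gcdf x @[x --> +oo] --> (1 : R).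
Proof.
apply: fine_cvg; have := cvg_cdfy1 (idR : {RV (normal_prob 0 1) >-> R}).
by under eq_cvg do rewrite cdf_idR -GcdfE.
Qed.

Lemma cvg_GcdfNy : Gcdf x @[x --> -oo] --> (0 : R).
Proof.
apply: fine_cvg; have := cvg_cdfNy0 (idR : {RV (normal_prob 0 1) >-> R}).
by under eq_cvg do rewrite cdf_idR -GcdfE.
Qed.

Lemma continuous_Gcdf : continuous Gcdf.
Proof.
move=> x; apply: differentiable_continuous; apply/derivable1_diffP.
by have [] := is_derive_Gcdf x.
Qed.

(** Change of variables z = x / s: every centered Gaussian law is a rescaled
standard one, which leaves a single distribution function to study. *)
Lemma normal_prob0E s x : 0 < s ->
  normal_prob 0 s `]-oo, x]%classic = (Gcdf (x / s))%:E.
Proof.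
move=> s0; rewrite -GcdfE.
pose F (z : R) := z / s.
have dF (z : R) : is_derive z 1 F s^-1.
  have := is_derive_mul (is_derive_id z 1) (is_derive_cst (s^-1) z 1).
  by move=> /trigger_derive; apply; rewrite /cst mul1r mulr0 addr0.
have F'E : F^`()%classic = cst s^-1 by apply/funext => z; rewrite derive1E derive_val.
have Fx (z : R) : derivable F z 1 by case: (dF z).
have cF : continuous F.
  by move=> z; apply: differentiable_continuous; apply/derivable1_diffP.
rewrite /normal_prob -[x / s]/(F x).
rewrite (@increasing_ge0_integration_by_substitutionNy _ F (normal_pdf 0 1) x).
- apply: eq_integral => z _; congr EFin.
  rewrite !fctE F'E /cst !normal_pdfE ?oner_neq0 ?gt_eqF// /normal_fun !subr0.
  rewrite mulrAC; congr (_ * expR _).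
  + rewrite /normal_peak -invfM; congr (_^-1).
    rewrite -[X in _ = _ * X]ger0_norm ?ltW// -sqrtr_sqr -sqrtrM.
      by congr Num.sqrt; rewrite expr1n mul1r -mulrnAr mulrC.
    by rewrite mulrn_wge0// mulr_ge0 ?sqr_ge0 ?pi_ge0.
  + by rewrite /F expr1n -[in RHS]mulr_natr; field; rewrite gt_eqF.
- by move=> a b _ _ ab; rewrite /F ltr_pM2r ?invr_gt0.
- by rewrite F'E => z _; exact: cvg_cst.
- by rewrite F'E; exact: is_cvg_cst.
- by rewrite F'E; exact: cvg_cst.
- split; first by move=> z _.
  by apply: cvg_at_left_filter; exact: cF.
- by apply/gt0_cvgMlNy; [rewrite invr_gt0|exact: cvg_id].
- by apply: continuous_subspaceT => z; exact: continuous_normal_pdf (oner_neq0 _) z.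
- by move=> z _; exact: normal_pdf_ge0.
Qed.

End gaussian_cdf.

(** * Taylor bounds for the heat flow of the Gaussian distribution function *)

Section taylor.
Variable R : realType.

Lemma mean_value_le (f f1 : R -> R) (C a b : R) : a <= b ->
  (forall c : R, a <= c <= b -> is_derive c 1 f (f1 c)) ->
  (forall c, a <= c <= b -> `|f1 c| <= C) ->
  `|f b - f a| <= C * `|b - a|.
Proof.
move=> ab df bnd.
have [c cab| |c /[!in_itv]/= cab ->] := @MVT_segment R f f1 a b ab.
- by apply: df; move: cab; rewrite in_itv /= => /andP[/ltW-> /ltW->].
- apply: derivable_within_continuous => c; rewrite in_itv /= => cab.
  by case: (df c cab).
- by rewrite normrM ler_wpM2r//; exact: bnd.
Qed.

Lemma mean_value (f f1 : R -> R) (C : R) :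
  (forall x : R, is_derive x 1 f (f1 x)) -> forall a b : R,
  (forall c, `|c - a| <= `|b - a| -> `|f1 c| <= C) ->
  `|f b - f a| <= C * `|b - a|.
Proof.
move=> df a b bnd; have [ab|/ltW ba] := leP a b.
  apply: (@mean_value_le f f1 C a b ab) => c /andP[ac cb].
  by apply: bnd; rewrite !ger0_norm ?subr_ge0// lerD2r.
rewrite distrC (distrC b a).
apply: (@mean_value_le f f1 C b a ba) => c /andP[bc ca].
by apply: bnd; rewrite ![`|_ - a|]distrC !ger0_norm ?subr_ge0// lerD2l lerN2.
Qed.

(** Second order Taylor formula with a cubic remainder: two applications of the
mean value inequality, to f minus its Taylor polynomial and to the derivative
of that difference. *)
Lemma taylor2 (f f1 f2 f3 : R -> R) (C : R) :
  (forall x : R, is_derive x 1 f (f1 x)) ->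
  (forall x : R, is_derive x 1 f1 (f2 x)) ->
  (forall x : R, is_derive x 1 f2 (f3 x)) ->
  (forall x, `|f3 x| <= C) ->
  forall x h, `|f (x + h) - (f x + h * f1 x + h ^+ 2 / 2 * f2 x)|
              <= C * `|h| ^+ 3.
Proof.
move=> df df1 df2 f3C x h.
have C0 : 0 <= C by exact: le_trans (normr_ge0 _) (f3C 0).
pose g1 t := f1 t - f2 x * t.
pose g t := f t + f1 x * (x - t) - f2 x / 2 * (t - x) ^+ 2.
have dg1 (t : R) : is_derive t 1 g1 (f2 t - f2 x).
  have := is_deriveB (df1 t) (is_derive_mul (is_derive_cst (f2 x) t 1) (is_derive_id t 1)).
  by move=> /trigger_derive; apply; rewrite mul0r add0r mulr1.
have dg (t : R) : is_derive t 1 g (f1 t - f1 x - f2 x * (t - x)).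
  have D := is_deriveB (is_derive_id t 1) (is_derive_cst (x : R) t 1).
  have D2 := is_derive_mul (is_derive_cst (f2 x / 2 : R) t 1) (is_derive_mul D D).
  have D1 := is_derive_mul (is_derive_cst (f1 x) t 1) D.
  rewrite (_ : g = (fun t => f t - f1 x * (t - x) - f2 x / 2 * ((t - x) * (t - x)))).
    apply: trigger_derive (is_deriveB (is_deriveB (df t) D1) D2) _.
    rewrite !fctE /cst /=; lra.
  by apply/funext => z; rewrite /g; ring.
have b1 t : `|f1 t - f1 x - f2 x * (t - x)| <= C * `|t - x| ^+ 2.
  have -> : f1 t - f1 x - f2 x * (t - x) = g1 t - g1 x by rewrite /g1; ring.
  rewrite expr2 mulrA; apply: (mean_value dg1) => c cx.
  have := mean_value df2 (fun c _ => f3C c); move=> /(_ x c)/le_trans; apply.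
  by rewrite ler_wpM2l.
have -> : f (x + h) - (f x + h * f1 x + h ^+ 2 / 2 * f2 x) = g (x + h) - g x.
  by rewrite /g; field.
rewrite (_ : `|h| = `|x + h - x|); last by congr `|_|; ring.
rewrite exprSr mulrA; apply: (mean_value dg) => c cx.
apply: le_trans (b1 c) _; rewrite ler_wpM2l// lerXn2r ?nnegrE//.
Qed.

End taylor.

Section gaussian_step.
Variable R : realType.
Implicit Types x h w s t : R.
Local Notation Phi := (@Gcdf R).
Local Notation phi := (@Gpdf R).

(** One bound serves for all products of the density by a power of w at most 4,
which is all that occurs in the derivatives estimated below. *)
Lemma Gpdf_decay : exists2 K : R, 0 <= K & forall w, (1 + w ^+ 4) * phi w <= K.
Proof.
exists (16 * normal_peak 1); first by rewrite mulr_ge0// normal_peak_ge0.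
move=> w; rewrite GpdfE mulrCA mulrC ler_wpM2r ?normal_peak_ge0//.
rewrite mulNr expRN ler_pdivrMr ?expR_gt0//.
(* exp (w^2 / 2) is the square of exp (w^2 / 4), which is at least 1 + w^2 / 4. *)
have : 1 + w ^+ 2 / 4 <= expR (w ^+ 2 / 4) by exact: expR_ge1Dx.
rewrite (_ : w ^+ 2 / 2 = 2 * (w ^+ 2 / 4)); last by field.
have := sqr_ge0 w; rewrite expRM_natl.
move: (expR _) => e w0 e1; have -> : w ^+ 4 = (w ^+ 2) ^+ 2 by ring.
by nra.
Qed.

Let is_derive_scale (G dG : R -> R) (q x : R) :
  (forall w : R, is_derive w 1 G (dG w)) ->
  is_derive x 1 (fun z => G (z * q)) (dG (x * q) * q).
Proof.
move=> dGE.
have D := is_derive_mul (is_derive_id x 1) (is_derive_cst (q : R) x 1).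
by apply: trigger_derive (is_derive1_comp (dGE _) D) _; rewrite /cst; ring.
Qed.

(** Space expansion of u(s, x) = Phi(x / sqrt s), with q standing for
1 / sqrt s. *)
Lemma Gcdf_taylor (K : R) : (forall w, (1 + w ^+ 4) * phi w <= K) ->
  forall q x h, 0 <= q ->
  `|Phi ((x + h) * q) -
    (Phi (x * q) + h * (q * phi (x * q)) + h ^+ 2 / 2 * (q ^+ 2 * dGpdf (x * q)))|
  <= 2 * K * q ^+ 3 * `|h| ^+ 3.
Proof.
move=> HK q x h q0.
have D1 (z : R) : is_derive z 1 (fun z => Phi (z * q)) (q * phi (z * q)).
  by apply: trigger_derive (is_derive_scale _ _ (@is_derive_Gcdf R)) _; rewrite mulrC.
have D2 (z : R) : is_derive z 1 (fun z => q * phi (z * q)) (q ^+ 2 * dGpdf (z * q)).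
  apply: trigger_derive (is_derive_mul (is_derive_cst (q : R) z 1)
    (is_derive_scale _ _ (@is_derive_Gpdf R))) _.
  by rewrite /dGpdf /cst; ring.
have D3 (z : R) :
    is_derive z 1 (fun z => q ^+ 2 * dGpdf (z * q)) (q ^+ 3 * d2Gpdf (z * q)).
  apply: trigger_derive (is_derive_mul (is_derive_cst (q ^+ 2 : R) z 1)
    (is_derive_scale _ _ (@is_derive_dGpdf R))) _.
  by rewrite /cst; ring.
apply: (taylor2 D1 D2 D3) => {x h D1 D2 D3} x.
rewrite normrM (ger0_norm (exprn_ge0 _ q0)) mulrC ler_wpM2r ?exprn_ge0//.
rewrite /d2Gpdf; have := HK (x * q); have := Gpdf_ge0 (x * q).
move: (x * q) => w; move: (phi w) => p p0 {}HK; rewrite normrM (ger0_norm p0).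
rewrite -(@ler_pM2l _ (2^-1)) // mulrA mulrA mulVf // mul1r.
apply: le_trans HK; rewrite ler_wpM2r// ler_pdivrMl// ler_norml.
have := sqr_ge0 w; have -> : w ^+ 4 = (w ^+ 2) ^+ 2 by ring.
by move: (w ^+ 2) => u u0; nra.
Qed.

(** Time expansion of u(s, x) = Phi(x / sqrt s). The first order coefficient is
half of the second order space coefficient of [Gcdf_taylor]: this is the heat
equation for u. Away from s = 0 the second time derivative is bounded. *)
Lemma Gcdf_taylor_time (K : R) : (forall w, (1 + w ^+ 4) * phi w <= K) ->
  forall eps s t x, 0 < eps -> eps <= s -> 0 <= t ->
  `|Phi (x / Num.sqrt (s + t)) -
    (Phi (x / Num.sqrt s) + t / 2 * ((Num.sqrt s)^-1 ^+ 2 * dGpdf (x / Num.sqrt s)))|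
  <= 2 * K * (Num.sqrt eps)^-1 ^+ 4 * t ^+ 2.
Proof.
move=> HK eps s t x eps0 eps_s t0.
pose q s : R := (Num.sqrt s)^-1.
pose u1 s := 2^-1 * (q s ^+ 2 * dGpdf (x * q s)).
have sqrt_der (c : R) : 0 < c -> is_derive c 1 q (- 2^-1 * q c ^+ 3).
  move=> c0; have c1 : 0 < Num.sqrt c by rewrite sqrtr_gt0.
  apply: trigger_derive (is_deriveV (lt0r_neq0 c1) (is_derive1_sqrt c0)) _.
  transitivity (- (Num.sqrt c ^- 2) * (2 * Num.sqrt c)^-1) => //.
  by rewrite /q; field; rewrite gt_eqF.
have q0 c : 0 <= q c by rewrite /q invr_ge0 sqrtr_ge0.
have q_le (c : R) : s <= c -> q c <= q eps.
  move=> sc; have ec : eps <= c by exact: le_trans sc.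
  have c0 : 0 < c by exact: lt_le_trans ec.
  by rewrite /q lef_pV2 ?posrE ?sqrtr_gt0// ler_wsqrtr.
have du (c : R) : 0 < c -> is_derive c 1 (fun z => Phi (x * q z)) (u1 c).
  move=> c0; apply: trigger_derive (is_derive1_comp (is_derive_Gcdf _)
    (is_derive_mul (is_derive_cst (x : R) c 1) (sqrt_der _ c0))) _.
  by rewrite /u1 /dGpdf /cst; field.
have du1 (c : R) : 0 < c -> is_derive c 1 u1
    (- 2^-1 * q c ^+ 4 * (2^-1 * ((x * q c) * d2Gpdf (x * q c)) + dGpdf (x * q c))).
  move=> c0.
  have D2 := is_derive1_comp (is_derive_dGpdf _)
    (is_derive_mul (is_derive_cst (x : R) c 1) (sqrt_der _ c0)).
  have D1 := is_derive_mul (sqrt_der _ c0) (sqrt_der _ c0).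
  apply: trigger_derive (is_derive_mul (is_derive_cst (2^-1 : R) c 1)
    (is_derive_mul D1 D2)) _.
  by rewrite /cst /=; field.
have u1_lip c : s <= c -> `|u1 c - u1 s| <= 2 * K * q eps ^+ 4 * `|c - s|.
  move=> sc; have pos y : s <= y <= c -> 0 < y.
    by case/andP=> sy _; exact: lt_le_trans eps0 (le_trans eps_s sy).
  apply: (mean_value_le sc (fun y sy => du1 y (pos y sy))) => y /andP[sy yc].
  have A1 : `|- 2^-1 * q y ^+ 4| <= 2^-1 * q eps ^+ 4.
    rewrite mulNr normrN ger0_norm ?mulr_ge0 ?exprn_ge0 ?invr_ge0//.
    by rewrite ler_pM2l// lerXn2r ?nnegrE ?q_le.
  have A2 : `|2^-1 * (x * q y * d2Gpdf (x * q y)) + dGpdf (x * q y)| <= 4 * K.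
    rewrite /d2Gpdf /dGpdf; have := HK (x * q y); have := Gpdf_ge0 (x * q y).
    move: (x * q y) => w; move: (phi w) => p p0 HKw.
    have -> : 2^-1 * (w * ((w ^+ 2 - 1) * p)) + - w * p = ((w ^+ 3 - 3 * w) / 2) * p by field.
    rewrite normrM (ger0_norm p0); apply: (@le_trans _ _ (4 * (1 + w ^+ 4) * p)).
      rewrite ler_wpM2r// ler_norml.
      have := sqr_ge0 (w ^+ 2 - w); have := sqr_ge0 (w ^+ 2 + w).
      have := sqr_ge0 (w - 1); have := sqr_ge0 (w + 1); have := sqr_ge0 (w ^+ 2 - 1).
      by move=> *; apply/andP; split; lra.
    by rewrite -mulrA ler_pM2l.
  rewrite normrM; apply: le_trans (ler_pM _ _ A1 A2) _ => //.
  by rewrite le_eqVlt; apply/orP; left; apply/eqP; field.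
pose g z := Phi (x * q z) - u1 s * z.
have dg (c : R) : 0 < c -> is_derive c 1 g (u1 c - u1 s).
  move=> c0; have := is_deriveB (du c c0)
    (is_derive_mul (is_derive_cst (u1 s : R) c 1) (is_derive_id c 1)).
  by move=> /trigger_derive; apply; rewrite /cst; ring.
rewrite (_ : _ - _ = g (s + t) - g s); last first.
  by rewrite /g /u1 -/(q s) -/(q (s + t)); move: (q s) (q (s + t)) => a b; field.
have tE : t = `|s + t - s| by rewrite addrAC subrr add0r ger0_norm.
rewrite expr2 mulrA [X in _ <= _ * X]tE.
have st : s <= s + t by rewrite lerDl.
apply: (mean_value_le st) => [z /andP[sz _]|z /andP[sz zst]].
  exact/dg/lt_le_trans/(le_trans eps_s).
apply: le_trans (u1_lip z sz) _.
apply: ler_wpM2l; last by rewrite ger0_norm ?subr_ge0// lerBlDl.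
by rewrite !mulr_ge0 ?exprn_ge0// (le_trans _ (HK 0))// mulr_ge0 ?Gpdf_ge0 ?addr_ge0.
Qed.

(** Difference of the two expansions. The coefficients a and b do not depend on
h, so for h random, centered and of variance t, the terms in a and b vanish in
expectation: moving x by h has the effect of letting time t elapse, up to
third order in h. *)
Lemma Gcdf_heat_step eps : 0 < eps -> exists2 K : R, 0 <= K &
  forall s t x, eps <= s -> 0 <= t -> exists a b : R, forall h,
  `|Phi ((x + h) / Num.sqrt s) - Phi (x / Num.sqrt (s + t)) -
    (a * h + b * (h ^+ 2 - t))| <= K * (`|h| ^+ 3 + t ^+ 2).
Proof.
move=> eps0; have [K K0 HK] := Gpdf_decay; pose q s : R := (Num.sqrt s)^-1.
have q0 c : 0 <= q c by rewrite /q invr_ge0 sqrtr_ge0.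
pose C := 2 * K * q eps ^+ 3 + 2 * K * q eps ^+ 4.
exists C; first by rewrite addr_ge0 ?mulr_ge0 ?exprn_ge0.
move=> s t x es t0; exists (q s * phi (x * q s)), (2^-1 * (q s ^+ 2 * dGpdf (x * q s))) => h.
have := Gcdf_taylor HK x h (q0 s); have := Gcdf_taylor_time HK x eps0 es t0.
rewrite -!/(q _).
have qq : q s ^+ 3 <= q eps ^+ 3.
  rewrite lerXn2r ?nnegrE// /q lef_pV2 ?posrE ?sqrtr_gt0 ?ler_wsqrtr//.
  exact: lt_le_trans es.
move=> T1 T2; rewrite [leRHS]mulrDr.
set A := Phi _ in T2 *; set B := Phi _ in T1 *.
set D := Phi (x * q s) in T1 T2 *; set f := phi _ in T2 *; set g := dGpdf _ in T1 T2 *.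
rewrite (_ : _ - _ - _ = (A - (D + h * (q s * f) + h ^+ 2 / 2 * (q s ^+ 2 * g))) -
   (B - (D + t / 2 * (q s ^+ 2 * g)))); last by field.
apply: le_trans (ler_normB _ _) _; apply: lerD.
  apply: le_trans T2 _; rewrite ler_wpM2r ?exprn_ge0//.
  apply: (@le_trans _ _ (2 * K * q eps ^+ 3)).
    by rewrite ler_wpM2l// mulr_ge0.
  by rewrite /C lerDl !mulr_ge0// exprn_ge0.
apply: le_trans T1 _; rewrite ler_wpM2r ?sqr_ge0//.
by rewrite /C lerDr !mulr_ge0// exprn_ge0.
Qed.

End gaussian_step.

(** * A central limit theorem *)

Section translation_average.
Variables (R : realType) (rho : probability (measurableTypeR R) R).
Local Open Scope ereal_scope.
Implicit Types (g : R -> \bar R) (t : R).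

(** The expectation of g (t + Z) for Z of law rho. Its n-th iterate, applied to g
and taken at 0, is the expectation of g at a sum of n independent variables of
law rho: iteration stands for the convolution powers of rho. *)
Definition shift_average g t : \bar R := \int[rho]_z g (t + z)%R.

Definition nonneg_measurable g :=
  measurable_fun [set: R] g /\ forall t, 0 <= g t.

Lemma shift_average_nonneg_measurable g :
  nonneg_measurable g -> nonneg_measurable (shift_average g).
Proof.
move=> [mg g0]; split; last by move=> t; exact: integral_ge0.
apply: (@measurable_fun_fubini_tonelli_F _ _ _ _ R rho
  (fun p : measurableTypeR R * measurableTypeR R => g (p.1 + p.2)%R)) => //.
apply: measurableT_comp => //; exact: measurable_funD.
Qed.

Lemma iter_shift_average_nonneg_measurable n g :
  nonneg_measurable g -> nonneg_measurable (iter n shift_average g).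
Proof. by move=> hg; elim: n => //= n; exact: shift_average_nonneg_measurable. Qed.

Let shift_nonneg_measurable g t :
  nonneg_measurable g -> measurable_fun [set: measurableTypeR R] (fun z => g (t + z)%R).
Proof. by move=> [mg _]; apply: measurableT_comp => //; exact: measurable_funD. Qed.

Lemma le_shift_average g1 g2 : nonneg_measurable g1 -> nonneg_measurable g2 ->
  (forall t, g1 t <= g2 t) -> forall t, shift_average g1 t <= shift_average g2 t.
Proof.
move=> h1 h2 g12 t; apply: ge0_le_integral => //.
- by move=> z _; have [_] := h1; apply.
- exact: shift_nonneg_measurable h1.
- exact: shift_nonneg_measurable h2.
Qed.

Lemma le_iter_shift_average n g1 g2 : nonneg_measurable g1 -> nonneg_measurable g2 ->
  (forall t, g1 t <= g2 t) -> forall t, iter n shift_average g1 t <= iter n shift_average g2 t.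
Proof.
move=> h1 h2 g12; elim: n => //= n IH.
by apply: le_shift_average => //; exact: iter_shift_average_nonneg_measurable.
Qed.

Lemma nonneg_measurableDr g (c : R) : (0 <= c)%R ->
  nonneg_measurable g -> nonneg_measurable (fun t => g t + c%:E).
Proof.
move=> c0 [mg g0]; split; first exact: emeasurable_funD.
by move=> t; rewrite adde_ge0// lee_fin.
Qed.

Lemma shift_averageDr g (c : R) t : (0 <= c)%R -> nonneg_measurable g ->
  shift_average (fun t => g t + c%:E) t = shift_average g t + c%:E.
Proof.
move=> c0 hg; rewrite /shift_average ge0_integralD//.
- by rewrite integral_cst// [X in (_ + _ * X)%E](probability_setT rho) mule1.
- by move=> z _; have [_] := hg; apply.
- exact: shift_nonneg_measurable.
Qed.

Lemma iter_shift_averageDr n g (c : R) : (0 <= c)%R -> nonneg_measurable g ->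
  forall t, iter n shift_average (fun t => g t + c%:E) t = iter n shift_average g t + c%:E.
Proof.
move=> c0 hg; elim: n => //= n IH t.
rewrite -shift_averageDr//; last exact: iter_shift_average_nonneg_measurable.
by congr shift_average; apply/funext.
Qed.

End translation_average.

Lemma cvg_EFin_sandwich (R : realType) (u : (\bar R)^nat) (L : R) :
  (forall eta, 0 < eta ->
    \forall n \near \oo, ((L - eta)%:E <= u n)%E /\ (u n <= (L + eta)%:E)%E) ->
  u n @[n --> \oo] --> L%:E.
Proof.
move=> H; have fin eta (x : \bar R) :
    ((L - eta)%:E <= x)%E -> (x <= (L + eta)%:E)%E -> x \is a fin_num.
  move=> xL xR; rewrite fin_numE; apply/andP; split; apply/eqP => E.
  - by move: xL; rewrite E leeNy_eq.
  - by move: xR; rewrite E leye_eq.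
apply/fine_cvgP; split.
  by have := H 1 ltr01; apply: filterS => n [? ?]; exact: (fin 1).
apply/cvgrPdist_le => eta eta0; have := H eta eta0; apply: filterS => n [lo up].
have := fin _ _ lo up => /fineK uE; move: lo up; rewrite -uE !lee_fin /= => lo up.
by rewrite ler_norml; apply/andP; split; lra.
Qed.

Lemma near_div_sqrt (R : realType) (K eta : R) : 0 < eta ->
  \forall n \near \oo, K / Num.sqrt n%:R <= eta.
Proof.
move=> eta0; near=> n.
have n0 : 0 < n%:R :> R by rewrite ltr0n; near: n; exact: nbhs_infty_gt.
rewrite ler_pdivrMr ?sqrtr_gt0// mulrC -ler_pdivrMr//.
have [K0|K0] := leP (K / eta) 0; first by rewrite (le_trans K0)// sqrtr_ge0.
rewrite -[leLHS]ger0_norm ?(ltW K0)// -sqrtr_sqr ler_wsqrtr//.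
by near: n; exact: nbhs_infty_ger.
Unshelve. all: by end_near. Qed.

Section smoothing.
Variable R : realType.
Local Notation Phi := (@Gcdf R).

(** The indicator of the event t <= c * sqrt n for an unnormalised sum t,
smoothed by a Gaussian of variance s on the scale of t / sqrt n. *)
Definition smoothed (n : nat) (c s t : R) : \bar R :=
  (Phi ((c - t / Num.sqrt n%:R) / Num.sqrt s))%:E.

Lemma smoothed_nonneg_measurable n c s : nonneg_measurable (smoothed n c s).
Proof.
split; last by move=> t; rewrite lee_fin Gcdf_ge0.
apply/measurable_EFinP.
apply: measurableT_comp; first exact: continuous_measurable_fun (@continuous_Gcdf R).
by apply: measurable_funM => //; apply: measurable_funB => //; exact: measurable_funM.
Qed.

Lemma Gcdf_tails (eta : R) : 0 < eta ->
  exists2 M, 0 < M & forall x, M <= x -> 1 - eta <= Phi x /\ Phi (- x) <= eta.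
Proof.
move=> eta0.
have [M1 [M1r HM1]] : \forall x \near +oo, 1 - eta <= Phi x.
  have /cvgrPdist_le /(_ _ eta0) := @cvg_Gcdfy R.
  by apply: filterS => x; rewrite ler_norml => /andP[_]; rewrite lerBlDr addrC -lerBlDr.
have [M2 [M2r HM2]] : \forall x \near -oo, Phi x <= eta.
  have /cvgrPdist_le /(_ _ eta0) := @cvg_GcdfNy R.
  by apply: filterS => x; rewrite sub0r normrN; apply: le_trans; rewrite ler_norm.
exists (1 + `|M1| + `|M2|) => [|x Mx]; first by rewrite -addrA ltr_pwDl// addr_ge0.
have := ler_norm M1; have := ler_norm (- M2); rewrite normrN => nM2 nM1.
have := normr_ge0 M1; have := normr_ge0 M2 => N2 N1.
by split; [apply: HM1|apply: HM2]; lra.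
Qed.

(** If y is within d of c, then y - 2 d and y + 2 d are at least d away from c on
either side. With the smoothing variance d^4, that is d / d^2 = 1 / d standard
deviations, so that the error is a Gaussian tail beyond 1 / d. *)
Lemma smoothed_sandwich (n : nat) (d eta y c t : R) : (0 < n)%N -> 0 < d -> 0 <= eta ->
  (forall x, d^-1 <= x -> 1 - eta <= Phi x /\ Phi (- x) <= eta) -> `|y - c| <= d ->
  ((\1_`]-oo, c * Num.sqrt n%:R]%classic t)%:E
     <= smoothed n (y + 2 * d) (d ^+ 4) t + eta%:E)%E /\
  (smoothed n (y - 2 * d) (d ^+ 4) t
     <= (\1_`]-oo, c * Num.sqrt n%:R]%classic t)%:E + eta%:E)%E.
Proof.
move=> n0 d0 eta0 tails; rewrite ler_norml => /andP[yc1 yc2].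
have r0 : 0 < Num.sqrt n%:R :> R by rewrite sqrtr_gt0 ltr0n.
have sqrtd : Num.sqrt (d ^+ 4) = d ^+ 2.
  by rewrite (_ : d ^+ 4 = (d ^+ 2) ^+ 2) ?sqrtr_sqr ?ger0_norm ?sqr_ge0// -exprM.
have far x : d <= x -> d^-1 <= x / Num.sqrt (d ^+ 4).
  by move=> dx; rewrite sqrtd ler_pdivlMr ?exprn_gt0// expr2 mulKf// gt_eqF.
rewrite /smoothed -!EFinD !lee_fin indicE.
have -> : (t \in `]-oo, c * Num.sqrt n%:R]%classic) = (t / Num.sqrt n%:R <= c).
  by rewrite ler_pdivrMr//; apply/idP/idP; rewrite inE /= in_itv.
have [tc|tc] := leP (t / Num.sqrt n%:R) c; split.
- by rewrite -lerBlDr; apply: (tails _ _).1; apply: far; clear -tc yc1; lra.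
- by rewrite (le_trans (Gcdf_le1 _))// lerDl.
- by rewrite addr_ge0// Gcdf_ge0.
- rewrite add0r -[X in Phi X]opprK; apply: (tails _ _).2.
  by rewrite -mulNr; apply: far; clear -tc yc2; lra.
Qed.

End smoothing.

Section central_limit.
Variables (R : realType) (rho : probability (measurableTypeR R) R) (v : R).
Hypothesis v0 : 0 < v.
Hypothesis mean0 : (\int[rho]_z z%:E = 0)%E.
Hypothesis variance : (\int[rho]_z (z ^+ 2)%:E = v%:E)%E.
Hypothesis moment3 : rho.-integrable setT (fun z => (`|z| ^+ 3)%:E).
Local Notation Phi := (@Gcdf R).

Let B3 : R := \int[rho]_z (`|z| ^+ 3).

Let integrable_cst (a : R) : rho.-integrable setT (fun z => a%:E).
Proof. exact: (@finite_measure_integrable_cst _ _ _ rho setT a). Qed.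

Let integrable_dominated (p : R -> R) : measurable_fun [set: measurableTypeR R] p ->
  (forall z, `|p z| <= 1 + `|z| ^+ 3) -> rho.-integrable setT (fun z => (p z)%:E).
Proof.
move=> mp pb.
have := integrableD measurableT (integrable_cst 1) moment3.
apply: le_integrable => //; first exact/measurable_EFinP.
by move=> z _ /=; rewrite lee_fin (le_trans (pb z))// ler_norm.
Qed.

Let integrable_z : rho.-integrable setT (fun z => z%:E).
Proof.
apply: integrable_dominated => // z; have := normr_ge0 z; move: `|z| => a a0.
have : 0 <= a * (a - 1) ^+ 2 by rewrite mulr_ge0 ?sqr_ge0.
have := sqr_ge0 (a - 1); have := sqr_ge0 a; lra.
Qed.

Let integrable_z2 : rho.-integrable setT (fun z => (z ^+ 2)%:E).
Proof.
apply: integrable_dominated => [|z]; first exact: measurable_funX.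
rewrite normrX; have := normr_ge0 z; move: `|z| => a a0.
have : 0 <= a * (a - 1) ^+ 2 by rewrite mulr_ge0 ?sqr_ge0.
have := sqr_ge0 (a - 1); have := sqr_ge0 a; lra.
Qed.

(* The bounds that [Gcdf_heat_step] provides are functions of this shape. *)
Let cubic (a b c d z : R) := a + b * z + c * z ^+ 2 + d * `|z| ^+ 3.

Let EFin_cubic a b c d : (fun z => (cubic a b c d z)%:E) =
  (((fun=> a%:E) \+ (fun z => b%:E * z%:E)) \+ (fun z => c%:E * (z ^+ 2)%:E)
    \+ (fun z => d%:E * (`|z| ^+ 3)%:E))%E.
Proof. by apply/funext. Qed.

Let integrable_cubic a b c d : rho.-integrable setT (fun z => (cubic a b c d z)%:E).
Proof.
rewrite EFin_cubic.
by repeat (apply: integrableD => //); apply: integrableZl.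
Qed.

Let integral_cubic a b c d :
  (\int[rho]_z (cubic a b c d z)%:E = (a + c * v + d * B3)%:E)%E.
Proof.
rewrite EFin_cubic.
have Ib : rho.-integrable setT (fun z => b%:E * z%:E)%E by exact: integrableZl.
have Ic : rho.-integrable setT (fun z => c%:E * (z ^+ 2)%:E)%E by exact: integrableZl.
have Id : rho.-integrable setT (fun z => d%:E * (`|z| ^+ 3)%:E)%E by exact: integrableZl.
rewrite integralD//; last exact: integrableD (integrableD measurableT (integrable_cst a) Ib) Ic.
rewrite integralD//; last exact: integrableD.
rewrite integralD// !integralZl// integral_cst// [X in (_ * X)%E](probability_setT rho).
rewrite mean0 variance mule0 adde0 mule1 !EFinD !EFinM; congr (_ + _ * _)%E.
by rewrite /B3 /Rintegral fineK//; exact: integrable_fin_num.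
Qed.

(** One step of Lindeberg's replacement: averaging over one more variable has
almost the effect of increasing the smoothing variance by v / n. The expansion
of [Gcdf_heat_step] is integrated against rho, whose moments kill everything
but the remainder. *)
Lemma shift_average_smoothed eps : 0 < eps -> exists2 K : R, 0 <= K &
  forall (n : nat) (s c t : R), (0 < n)%N -> eps <= s ->
  let e := K / Num.sqrt n%:R ^+ 3 in
  (shift_average rho (smoothed n c s) t <= smoothed n c (s + v / n%:R)%R t + e%:E)%E /\
  (smoothed n c (s + v / n%:R)%R t <= shift_average rho (smoothed n c s) t + e%:E)%E.
Proof.
move=> eps0; have [K0 K00 HK] := Gcdf_heat_step eps0.
exists (K0 * (B3 + v ^+ 2)); first by rewrite mulr_ge0// addr_ge0 ?sqr_ge0//; apply: Rintegral_ge0.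
move=> n s c t n0 es e; pose r : R := Num.sqrt n%:R.
have n0' : 0 < n%:R :> R by rewrite ltr0n.
have r0 : 0 < r by rewrite sqrtr_gt0.
have rr : r ^+ 2 = n%:R by rewrite sqr_sqrtr// ltW.
have r1 : 1 <= r by rewrite -(sqrtr1 R) ler_wsqrtr// ler1n.
have [a [b Hab]] := HK s (v / n%:R) (c - t / r) es (divr_ge0 (ltW v0) (ltW n0')).
pose u := Phi ((c - t / r) / Num.sqrt (s + v / n%:R)).
pose T := v / n%:R.
have Hab' (z : R) : `|Phi ((c - (t + z) / r) / Num.sqrt s) - u -
    (a * - (z / r) + b * (z ^+ 2 / r ^+ 2 - T))|
   <= K0 * ((`|z| / r) ^+ 3 + T ^+ 2).
  have := Hab (- z / r).
  rewrite (_ : c - t / r + - z / r = c - (t + z) / r); last first.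
    by rewrite mulrDl opprD addrA mulNr.
  rewrite mulNr sqrrN normrN normrM [(z / r) ^+ 2]exprMn.
  by rewrite [`|r^-1|]ger0_norm ?invr_ge0 ?(ltW r0)// exprVn.
have ig : rho.-integrable setT (fun z : R => smoothed n c s (t + z)).
  apply: integrable_dominated => [|z].
    apply: measurableT_comp; first exact: continuous_measurable_fun (@continuous_Gcdf R).
    apply: measurable_funM => //; apply: measurable_funB => //.
    by apply: measurable_funM => //; exact: measurable_funD.
  by rewrite ger0_norm ?Gcdf_ge0// (le_trans (Gcdf_le1 _))// lerDl.
have e_ge : K0 * (B3 / r ^+ 3 + T ^+ 2) <= e.
  rewrite /e -/r -mulrA ler_wpM2l// mulrDl lerD2l /T -rr expr_div_n.
  rewrite ler_wpM2l ?sqr_ge0// -exprM lef_pV2 ?posrE ?exprn_gt0//.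
  by rewrite ler_weXn2l.
(* For k = 1 and k = -1, the integrals of the upper and of the lower bound. *)
have normal_form k : u + k * (K0 * (B3 / r ^+ 3 + T ^+ 2)) =
    u - b * T + k * K0 * T ^+ 2 + b / r ^+ 2 * v + k * K0 / r ^+ 3 * B3.
  by rewrite /T -rr; field; rewrite gt_eqF.
split.
- apply: (@le_trans _ _ (\int[rho]_z (cubic (u - b * T + 1 * K0 * T ^+ 2)
      (- a / r) (b / r ^+ 2) (1 * K0 / r ^+ 3) z)%:E)%E).
    apply: le_integral => // z _; rewrite lee_fin /cubic.
    have := Hab' z; rewrite ler_norml => /andP[_]; rewrite lerBlDl lerBlDl => /le_trans; apply.
    by rewrite le_eqVlt; apply/orP; left; apply/eqP; field; rewrite gt_eqF.
  by rewrite integral_cubic -EFinD lee_fin -/u -normal_form lerD2l mul1r.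
- rewrite -lee_subel_addr//; last exact: integrable_fin_num.
  apply: (@le_trans _ _ (\int[rho]_z (cubic (u - b * T + (-1) * K0 * T ^+ 2)
      (- a / r) (b / r ^+ 2) ((-1) * K0 / r ^+ 3) z)%:E)%E).
    by rewrite integral_cubic -EFinB lee_fin -/u -normal_form lerD2l mulN1r lerN2.
  apply: le_integral => // z _; rewrite lee_fin /cubic.
  have := Hab' z; rewrite ler_norml => /andP[+ _]; rewrite lerBrDr lerBrDr; apply: le_trans.
  by rewrite le_eqVlt; apply/orP; left; apply/eqP; field; rewrite gt_eqF.
Qed.

(** The n steps add up to a total error of order 1 / sqrt n, and to a total
increase v of the smoothing variance. *)
Lemma iter_shift_average_smoothed eps : 0 < eps -> exists2 K : R, 0 <= K &
  forall (n : nat) (c : R), (0 < n)%N ->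
  (iter n (shift_average rho) (smoothed n c eps) 0%R <=
     (Phi (c / Num.sqrt (eps + v)) + K / Num.sqrt n%:R)%:E)%E /\
  ((Phi (c / Num.sqrt (eps + v)) - K / Num.sqrt n%:R)%:E <=
     iter n (shift_average rho) (smoothed n c eps) 0%R)%E.
Proof.
move=> eps0; have [K K0 HK] := shift_average_smoothed eps0; exists K => // n c n0.
have n0' : 0 < n%:R :> R by rewrite ltr0n.
have r0 : 0 < Num.sqrt n%:R :> R by rewrite sqrtr_gt0.
pose e := K / Num.sqrt n%:R ^+ 3.
have e0 : 0 <= e by rewrite divr_ge0// exprn_ge0// ltW.
pose s (k : nat) : R := eps + k%:R * (v / n%:R).
have sS k : s k.+1 = s k + v / n%:R by rewrite /s -natr1 mulrDl mul1r addrA.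
have es k : eps <= s k by rewrite lerDl mulr_ge0// divr_ge0// ltW.
have step k t := HK n (s k) c t n0 (es k).
have smooth_nn k : nonneg_measurable (smoothed n c (s k)).
  exact: smoothed_nonneg_measurable.
have iter_nn k : nonneg_measurable (iter k (shift_average rho) (smoothed n c (s 0%N))).
  exact: iter_shift_average_nonneg_measurable.
have tele k t :
    (iter k (shift_average rho) (smoothed n c (s 0%N)) t <= smoothed n c (s k) t + (k%:R * e)%:E)%E /\
    (smoothed n c (s k) t <= iter k (shift_average rho) (smoothed n c (s 0%N)) t + (k%:R * e)%:E)%E.
  elim: k t => [|k IH] t; first by rewrite mul0r adde0.
  have ke0 : 0 <= k%:R * e by rewrite mulr_ge0.
  have [step1 step2] := step k t.
  rewrite -natr1 mulrDl mul1r EFinD sS; split.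
    apply: le_trans (_ : _ <= shift_average rho
        (fun t' => smoothed n c (s k) t' + (k%:R * e)%:E) t)%E _.
      exact: (le_shift_average rho (iter_nn k) (nonneg_measurableDr ke0 (smooth_nn k))
        (fun t' => (IH t').1)).
    by rewrite shift_averageDr// [X in (_ <= _ + X)%E]addeC addeA leeD2r.
  apply: le_trans step2 _; rewrite addeA leeD2r//.
  rewrite iterS -(shift_averageDr rho t ke0 (iter_nn k)).
  exact: (le_shift_average rho (smooth_nn k) (nonneg_measurableDr ke0 (iter_nn k))
    (fun t' => (IH t').2)).
have ne : n%:R * e = K / Num.sqrt n%:R.
  rewrite /e -[X in X * _](@sqr_sqrtr _ n%:R); last exact: ltW.
  by field; rewrite gt_eqF.
have s0 : s 0%N = eps by rewrite /s mul0r addr0.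
have sn : s n = eps + v by rewrite /s mulrC divfK// gt_eqF.
have [] := tele n 0; rewrite ne s0 sn /smoothed mul0r subr0.
split; first by rewrite EFinD.
by rewrite EFinB leeBlDr.
Qed.

(* As d tends to 0, the smoothing variance d^4 and the shift 2 d of the threshold
vanish, while the tails of [smoothed_sandwich], beyond 1 / d, do so too. *)
Let smoothing_parameter (y eta : R) : 0 < eta -> exists2 d : R, 0 < d & [/\
  (forall x, d^-1 <= x -> 1 - eta <= Phi x /\ Phi (- x) <= eta),
  Phi ((y + 2 * d) / Num.sqrt (d ^+ 4 + v)) <= Phi (y / Num.sqrt v) + eta &
  Phi (y / Num.sqrt v) - eta <= Phi ((y - 2 * d) / Num.sqrt (d ^+ 4 + v))].
Proof.
move=> eta0; have [M M0 HM] := Gcdf_tails eta0.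
have cont (k : R) : Phi ((y + k * d) / Num.sqrt (d ^+ 4 + v)) @[d --> (0 : R)^'+]
    --> Phi (y / Num.sqrt v).
  apply: cvg_at_right_filter.
  have -> : Phi (y / Num.sqrt v) = Phi ((y + k * 0) / Num.sqrt (0 ^+ 4 + v)).
    by rewrite expr0n /= mulr0 addr0 add0r.
  apply: (@continuous_comp _ _ _ (fun d : R => (y + k * d) / Num.sqrt (d ^+ 4 + v)) Phi);
    last exact: continuous_Gcdf.
  apply: continuousM.
    by apply: continuousD; [exact: cvg_cst|apply: continuousM; [exact: cvg_cst|exact: cvg_id]].
  apply: continuousV; first by rewrite gt_eqF// sqrtr_gt0 expr0n add0r.
  apply: continuous_comp; last exact: sqrt_continuous.
  by apply: continuousD; [exact: exprn_continuous|exact: cvg_cst].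
have /cvgrPdist_le /(_ _ eta0) near1 := cont 2.
have /cvgrPdist_le /(_ _ eta0) near2 := cont (- 2).
near (0 : R)^'+ => d; have d0 : 0 < d by [].
exists d => //; split.
- move=> x dx; apply: HM; apply: le_trans dx.
  rewrite -[M]invrK lef_pV2 ?posrE ?invr_gt0//.
  by near: d; apply: nbhs_right_le; rewrite invr_gt0.
- have : `|Phi (y / Num.sqrt v) - Phi ((y + 2 * d) / Num.sqrt (d ^+ 4 + v))| <= eta.
    by near: d; exact: near1.
  by rewrite ler_norml => /andP[+ _]; rewrite lerBrDr addrC lerBlDr.
- have : `|Phi (y / Num.sqrt v) - Phi ((y + - 2 * d) / Num.sqrt (d ^+ 4 + v))| <= eta.
    by near: d; exact: near2.
  by rewrite ler_norml mulNr => /andP[_]; rewrite lerBlDr addrC -lerBlDr.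
Unshelve. all: by end_near. Qed.

(** The sum of n independent variables of law rho stays below c n * sqrt n with
a probability that tends to the Gaussian one; the thresholds c n are allowed to
vary, as required by the nonlinear change of variable that leads from distances
to sums. *)
Theorem central_limit (c : R^nat) (y : R) : c n @[n --> \oo] --> y ->
  iter n (shift_average rho) (fun t => (\1_`]-oo, c n * Num.sqrt n%:R]%classic t)%:E) 0
    @[n --> \oo] --> (Phi (y / Num.sqrt v))%:E.
Proof.
have thirds_up (a b k e : R) : a <= b + e / 3 -> k <= e / 3 -> a + k + e / 3 <= b + e.
  by lra.
have thirds_low (a b k e : R) : b - e / 3 <= a -> k <= e / 3 -> b - e <= a - k - e / 3.
  by lra.
move=> cy; apply: cvg_EFin_sandwich => eta eta0.
have eta3 : 0 < eta / 3 by rewrite divr_gt0.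
have [d d0 [tails up low]] := smoothing_parameter y eta3.
have [K K0 HK] := iter_shift_average_smoothed (exprn_gt0 4 d0).
have near1 := near_div_sqrt K eta3.
have /cvgrPdist_le /(_ _ d0) near2 := cy.
near=> n.
have n0 : (0 < n)%N by near: n; exact: nbhs_infty_gt.
have Kn3 : K / Num.sqrt n%:R <= eta / 3 by near: n; exact: near1.
have ycd : `|y - c n| <= d by near: n; exact: near2.
have [up1 _] := HK n (y + 2 * d) n0; have [_ low1] := HK n (y - 2 * d) n0.
have sandwich t := smoothed_sandwich t n0 d0 (ltW eta3) tails ycd.
set ind := fun t => (\1_`]-oo, c n * Num.sqrt n%:R]%classic t)%:E.
have ind_nn : nonneg_measurable ind.
  by split=> [|t]; [exact/measurable_EFinP/measurable_indic|rewrite lee_fin].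
have smooth_nn y' := smoothed_nonneg_measurable n y' (d ^+ 4).
have ind_up : (iter n (shift_average rho) ind 0%R <=
    iter n (shift_average rho) (smoothed n (y + 2 * d) (d ^+ 4)) 0%R + (eta / 3)%:E)%E.
  rewrite -(iter_shift_averageDr rho n (ltW eta3) (smooth_nn _)).
  apply: le_iter_shift_average => [//||t]; last exact: (sandwich t).1.
  exact: nonneg_measurableDr (ltW eta3) (smooth_nn _).
have ind_low : (iter n (shift_average rho) (smoothed n (y - 2 * d) (d ^+ 4)) 0%R
    <= iter n (shift_average rho) ind 0%R + (eta / 3)%:E)%E.
  rewrite -(iter_shift_averageDr rho n (ltW eta3) ind_nn).
  apply: le_iter_shift_average => [//||t]; last exact: (sandwich t).2.
  exact: nonneg_measurableDr (ltW eta3) ind_nn.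
split.
- have := le_trans low1 ind_low; rewrite -leeBlDr// -EFinB; apply: le_trans.
  by rewrite lee_fin; exact: thirds_low low Kn3.
- apply: le_trans ind_up _; apply: le_trans (leeD2r _ up1) _.
  by rewrite -EFinD lee_fin; exact: thirds_up up Kn3.
Unshelve. all: by end_near. Qed.

End central_limit.

(** * The uniform law on the cube *)

Section uniform_cube.
Variable R : realType.

Lemma ltN11 : (-1 < 1 :> R)%R.
Proof. by rewrite (lt_trans (ltrN10 _)). Qed.

Definition uniform11 : probability (measurableTypeR R) R := uniform_prob ltN11.

(* [cons_rV] on the copy of the real line that carries its Borel structure, so
that it can be used as a random variable. *)
Definition cons_fun n : (measurableTypeR R * 'rV[R]_n)%type -> 'rV[R]_n.+1 :=
  @cons_rV R n.

HB.instance Definition _ n :=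
  isMeasurableFun.Build _ _ _ _ (@cons_fun n) (@measurable_cons_rV R n).

(** The uniform law on the cube, built one coordinate at a time like
[lebesgue_rV]: this gives the independence of the coordinates, in the form of
iterated integrals, by construction. *)
Fixpoint cube_prob n : probability 'rV[R]_n R :=
  if n is n'.+1 then
    distribution (uniform11 \x cube_prob n')%E (@cons_fun n')
  else \d_(0 : 'rV[R]_0).

Lemma cube_probSE n (A : set 'rV[R]_n.+1) :
  cube_prob n.+1 A = (uniform11 \x cube_prob n)%E (@cons_rV R n @^-1` A).
Proof. by []. Qed.

Definition box n (r : R) : set 'rV[R]_n := [set x | `|x| <= r].

Lemma rV_norm_le n (x : 'rV[R]_n) r : 0 <= r ->
  (`|x| <= r) <-> (forall i, `|x ord0 i| <= r).
Proof.
move=> r0; rewrite [`|x|]/Num.norm /= mx_normrE; split.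
  by move=> /bigmax_leP[_ H] i; exact: (H (ord0, i)).
by move=> H; apply/bigmax_leP; split => // -[i j] _ /=; rewrite (ord1 i).
Qed.

Lemma box_cons n (r : R) : 0 <= r ->
  @cons_rV R n @^-1` box r = `[- r, r]%classic `*` box r.
Proof.
move=> r0; apply/seteqP; split => -[a x] /=; rewrite /box /= in_itv /= -ler_norml.
  move=> /(rV_norm_le _ r0) H; split.
    have := H (lshift n ord0 : 'I_(1 + n)); rewrite /cons_rV /=.
    by rewrite [X in `|X|](row_mxEl (a%:M : 'rV_1) x) mxE eqxx.
  apply/(rV_norm_le _ r0) => i.
  have := H (rshift 1 i : 'I_(1 + n)); rewrite /cons_rV /=.
  by rewrite [X in `|X|](row_mxEr (a%:M : 'rV_1) x).
move=> [ar /(rV_norm_le _ r0) xr]; apply/(rV_norm_le _ r0) => i.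
rewrite /cons_rV /=; have [k ->|k ->] := split_ordP (i : 'I_(1 + n)).
  by rewrite [X in `|X|](row_mxEl (a%:M : 'rV_1) x) mxE !ord1 eqxx.
by rewrite [X in `|X|](row_mxEr (a%:M : 'rV_1) x).
Qed.

Lemma measurable_norm_rV n : measurable_fun [set: 'rV[R]_n] (fun x : 'rV[R]_n => `|x|).
Proof. apply: continuous_measurable_mx; exact: norm_continuous. Qed.

Lemma measurable_box n (r : R) : measurable (box r : set 'rV[R]_n).
Proof.
rewrite (_ : box r = (fun x : 'rV[R]_n => `|x|) @^-1` `]-oo, r]%classic).
  by rewrite -[X in measurable X]setTI; apply: measurable_norm_rV.
by apply/seteqP; split => x; rewrite /box /= in_itv.
Qed.

Lemma uniform11E (A : set R) : measurable A ->
  uniform11 A = ((2^-1)%:E * lebesgue_measure (A `&` `[-1, 1]%classic)%R)%E.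
Proof.
move=> mA.
rewrite -[LHS]/(\int[lebesgue_measure]_(x in A) (uniform_pdf (-1) 1 x)%:E)%E.
rewrite integral_uniform_pdf (eq_integral (fun=> (2^-1)%:E)); last first.
  move=> x; rewrite inE /= in_itv /= => -[_ x11]; rewrite /uniform_pdf x11 opprK.
  by congr (_^-1)%:E; ring.
by rewrite integral_cst//; exact: measurableI.
Qed.

Lemma uniform11_itv (r : R) : 0 <= r <= 1 -> uniform11 `[- r, r]%classic = r%:E.
Proof.
move=> /andP[r0 r1]; rewrite uniform11E// setIidl; last first.
  by apply: subset_itv; rewrite bnd_simp// lerN2.
rewrite lebesgue_measure_itv /= lte_fin.
case: ifPn => [_|]; first by rewrite -EFinB -EFinM opprK; congr EFin; field.
rewrite -leNgt => rr; have -> : r = 0 by apply/eqP; rewrite eq_le r0 andbT; lra.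
by rewrite mule0.
Qed.

Lemma cube_prob_box n (r : R) : 0 <= r <= 1 -> cube_prob n (box r) = (r ^+ n)%:E.
Proof.
move=> /andP[r0 r1]; elim: n => [|n IH].
  rewrite /= diracE mem_set//= /box /=; apply/(rV_norm_le _ r0) => -[]//.
rewrite cube_probSE box_cons//.
rewrite product_measure1E//; last exact: measurable_box.
by rewrite [X in (_ * X)%E]IH [X in (X * _)%E]uniform11_itv ?r0// -EFinM exprS.
Qed.

(** Both sides are obtained by adding coordinates one by one, each of which
contributes the length 2 of [-1, 1]. *)
Lemma lebesgue_rV_cube n (A : set 'rV[R]_n) : measurable A ->
  lebesgue_rV R n (A `&` cube) = ((2 ^+ n)%:E * cube_prob n A)%E.
Proof.
elim: n A => [|n IH] A mA.
  rewrite expr0 mul1e /=; congr (\d_ _ _); rewrite setIidl// => x _.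
  by apply/(rV_norm_le _ ler01) => -[].
have cubeE : cube = box 1 :> set 'rV[R]_n.+1 by [].
rewrite cube_probSE cubeE /=  /lebesgue_rV_step /pushforward preimage_setI box_cons//.
pose psi a := cube_prob n (xsection (@cons_rV R n @^-1` A) a).
have mcons : measurable (@cons_rV R n @^-1` A).
  by rewrite -[X in measurable X]setTI; exact: measurable_cons_rV.
have mpsi : measurable_fun [set: measurableTypeR R] psi.
  exact: measurable_fun_xsection.
have -> : (uniform11 \x cube_prob n)%E (@cons_rV R n @^-1` A) = (\int[uniform11]_a psi a)%E.
  by [].
rewrite integral_uniform// muleA -EFinM exprS mulrC.
have -> : (1 - -1 : R)^-1 * (2 * 2 ^+ n) = 2 ^+ n by rewrite opprK; field.
rewrite -ge0_integralZl//; last exact: measurable_funTS.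
rewrite /product_measure1 /= [RHS]integral_mkcond; apply: eq_integral => a _.
rewrite patchE; case: ifPn => a11.
- rewrite -IH; last exact: measurable_xsection.
  congr (lebesgue_rV R n _); apply/seteqP; split => x.
    by rewrite /xsection /= !inE /= => -[? []].
  rewrite /xsection /= !inE /= => -[? ?]; split => //; split => //.
  by move: a11; rewrite inE.
- rewrite (_ : xsection _ _ = set0) ?measure0//.
  apply/seteqP; split => x //; rewrite /xsection /= inE /= => -[_ [a11' _]].
  by move: a11; rewrite notin_setE; apply.
Qed.

End uniform_cube.

(** * The cone measure as the image of the uniform law *)

Section cone_law.
Variable R : realType.

Lemma cube_boundaryE n : @cube_boundary R n = [set x | `|x| = 1].
Proof.
have cnorm : continuous (fun x : 'rV[R]_n => `|x|) by exact: norm_continuous.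
have clC : closed (@cube R n).
  rewrite (_ : cube = (fun x : 'rV[R]_n => `|x|) @^-1` [set y | y <= 1]) //.
  apply: closed_comp; [by move=> x _; exact: cnorm|exact: closed_le].
rewrite /cube_boundary /topological_boundary -(closure_id _).1//.
apply/seteqP; split => x /=.
- move=> [x1 nix]; apply/eqP; rewrite eq_le x1 leNgt; apply/negP => lt1.
  apply: nix; rewrite /interior.
  have : nbhs x ((fun x : 'rV[R]_n => `|x|) @^-1` [set y | y < 1]).
    by apply: open_nbhs_nbhs; split => //; apply: open_comp => //; exact: open_lt.
  by apply: filterS => y /ltW.
- move=> x1; split; first by rewrite /cube /= x1.
  (* A boundary point stretched by 1 + e / 2 leaves the cube but stays in the ball. *)
  move=> /nbhs_ballP[e /= e0] /(_ ((1 + e / 2) *: x)).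
  have : ball x e ((1 + e / 2) *: x).
    rewrite -ball_normE /ball_ /= scalerDl scale1r opprD addrA subrr sub0r normrN.
    by rewrite normrZ x1 mulr1 ger0_norm ?divr_ge0 ?ltW// ltr_pdivrMr// ltr_pMr// ltr1n.
  move=> /[swap] /[apply]; rewrite /cube /= normrZ x1 mulr1 ger0_norm; last first.
    by rewrite addr_ge0// divr_ge0// ltW.
  by rewrite gerDl leNgt divr_gt0.
Qed.

Definition normalize n (x : 'rV[R]_n) : 'rV[R]_n := `|x|^-1 *: x.

Lemma measurable_normalize n : measurable_fun [set: 'rV[R]_n] (@normalize n).
Proof.
apply: measurable_fun_mx => i j; rewrite /normalize.
(* A power with exponent -1 is the inverse on the nonnegative reals, 0 included. *)
under eq_fun do rewrite mxE -powR_inv1//.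
apply: measurable_funM; last exact: measurable_coord_mx.
have mN := @measurable_norm_rV R n.
apply: (measurableT_comp (measurable_powR _) mN).
Qed.

Lemma lebesgue_rV_cube_size n : lebesgue_rV R n cube = (2 ^+ n)%:E.
Proof.
have := @lebesgue_rV_cube R n setT measurableT.
by rewrite setTI probability_setT mule1.
Qed.

Let div2n n (x : \bar R) : ((2 ^+ n)%:E * x / (2 ^+ n)%:E = x)%E.
Proof.
have n20 : 2 ^+ n != 0 :> R by rewrite expf_neq0.
by rewrite inver (negbTE n20) muleAC -EFinM divff// mul1e.
Qed.

Lemma cube_uniformE n (A : set 'rV[R]_n) : measurable A ->
  (lebesgue_rV R n (A `&` cube) / lebesgue_rV R n cube)%E = cube_prob R n A.
Proof. by move=> mA; rewrite lebesgue_rV_cube// lebesgue_rV_cube_size div2n. Qed.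

(** Outside of the origin, which is a null set, a point x of the cube lies in
the cone spanned by a part A of the boundary exactly when x / |x| lies in A. *)
Lemma cone_measureE n (A : set 'rV[R]_n) : (0 < n)%N -> measurable A ->
  cone_measure (A `&` cube_boundary) = cube_prob R n (@normalize n @^-1` A).
Proof.
move=> n0 mA.
have mN : measurable (@normalize n @^-1` A).
  by rewrite -[X in measurable X]setTI; exact: measurable_normalize.
rewrite -cube_uniformE// /cone_measure; congr (_ / _)%E.
set C := _ `&` cube; set B := cone _.
have mC : measurable C by apply: measurableI => //; exact: (@measurable_box R n 1).
have box0 : box 0 = [set 0] :> set 'rV[R]_n.
  apply/seteqP; split => x; rewrite /box /=; first by rewrite normr_le0 => /eqP.
  by move=> ->; rewrite normr0.
have m0 : measurable [set 0 : 'rV[R]_n] by rewrite -box0; exact: measurable_box.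
have null0 : lebesgue_rV R n [set 0] = 0%E.
  rewrite (_ : [set 0] = [set 0] `&` cube); last first.
    by rewrite setIidl// => x ->; rewrite /cube /= normr0.
  rewrite lebesgue_rV_cube// -box0 cube_prob_box ?lexx ?ler01//.
  by rewrite expr0n -(negbK (n == 0)%N) -lt0n n0 mule0.
have BC x : x != 0 -> B x <-> C x.
  move=> x0; have nx0 : 0 < `|x| by rewrite normr_gt0.
  split.
    move=> [a [t [[Aa]]]]; rewrite cube_boundaryE /= => a1 /andP[t0 t1 xE].
    have xt : `|x| = t by rewrite xE normrZ a1 mulr1 ger0_norm.
    split; last by rewrite /cube /= xt.
    rewrite /= /normalize xt {1}xE scalerA mulVf ?scale1r//.
    by rewrite -xt gt_eqF.
  move=> [/= Ax x1]; exists (normalize x), `|x|; split.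
  - split => //; rewrite cube_boundaryE /= /normalize normrZ ger0_norm ?invr_ge0//.
    by rewrite mulVf// gt_eqF.
  - by rewrite normr_ge0.
  - by rewrite /normalize scalerA mulfV ?scale1r// gt_eqF.
have mB : measurable B.
  rewrite (_ : B = (C `\ 0) `|` (B `&` [set 0])).
    apply: measurableU; first exact: measurableD.
    have [B0|B0] := pselect (B 0).
      by rewrite (_ : B `&` [set 0] = [set 0])// setIidr// => x ->.
    by rewrite (_ : B `&` [set 0] = set0)// -subset0 => x [Bx xE]; apply: B0; rewrite -xE.
  apply/seteqP; split => x.
    by have [->|x0] := eqVneq x 0; [right|move=> /(BC _ x0) ?; left; split => //; apply/eqP].
  by move=> [[Cx /eqP x0]|[]//]; apply/BC.
have sub0 (D1 D2 : set 'rV[R]_n) : measurable D1 -> measurable D2 ->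
    (forall x, x != 0 -> D1 x -> D2 x) -> (lebesgue_rV R n D1 <= lebesgue_rV R n D2)%E.
  move=> m1 m2 D12; apply: (@le_trans _ _ (lebesgue_rV R n (D2 `|` [set 0]))).
    apply: le_measure; rewrite ?inE//; first exact: measurableU.
    by move=> x Dx; have [->|x0] := eqVneq x 0; [right|left; exact: D12].
  by apply: le_trans (measureU2 _ _ _) _ => //; rewrite [X in (_ + X)%E]null0 adde0.
by apply/eqP; rewrite eq_le; apply/andP; split; apply: sub0 => // x x0 /(BC _ x0).
Qed.

End cone_law.

(** * The law of the squared distance in the cube *)

Section squared_distance.
Variable R : realType.
Local Notation U := (uniform11 R).
Local Notation Q := (cube_prob R).

Definition sqdist n (x y : 'rV[R]_n) : R := \sum_(i < n) (x ord0 i - y ord0 i) ^+ 2.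

Lemma sqdist_cons n a b (x y : 'rV[R]_n) :
  sqdist (cons_rV (a, x)) (cons_rV (b, y)) = (a - b) ^+ 2 + sqdist x y.
Proof.
rewrite /sqdist big_ord_recl; congr (_ + _).
  have E0 c (z : 'rV[R]_n) : cons_rV (c, z) ord0 ord0 = c.
    by have := cons_rVK (c, z) => /(congr1 fst).
  by rewrite !E0.
apply: eq_bigr => i _.
have ES c (z : 'rV[R]_n) : cons_rV (c, z) ord0 (lift ord0 i) = z ord0 i.
  rewrite /cons_rV /= -(row_mxEr (c%:M : 'rV_1) z); congr (row_mx _ _ _ _).
  exact: val_inj.
by rewrite !ES.
Qed.

Lemma measurable_sqdist n :
  measurable_fun setT (fun p : 'rV[R]_n * 'rV[R]_n => sqdist p.1 p.2).
Proof.
apply: measurable_sum => i; apply: measurable_funX; apply: measurable_funB.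
  exact: measurableT_comp (@measurable_coord_mx R 1 n ord0 i) measurable_fst.
exact: measurableT_comp (@measurable_coord_mx R 1 n ord0 i) measurable_snd.
Qed.

Definition centered_square (p : measurableTypeR R * measurableTypeR R) : measurableTypeR R :=
  (p.1 - p.2 : R) ^+ 2 - 2 / 3.

Lemma measurable_centered_square : measurable_fun setT centered_square.
Proof.
apply: measurable_funB => //; apply: measurable_funX; exact: measurable_funB.
Qed.

HB.instance Definition _ :=
  isMeasurableFun.Build _ _ _ _ centered_square measurable_centered_square.

Definition centered_square_law : probability (measurableTypeR R) R :=
  distribution (U \x U)%E centered_square.

Lemma integral_centered_square_law (g : R -> \bar R) : nonneg_measurable g ->
  (\int[centered_square_law]_z g z = \int[U]_a \int[U]_b g (centered_square (a, b)))%E.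
Proof.
move=> [mg g0]; rewrite ge0_integral_distribution//.
rewrite fubini_tonelli1//= .
exact: measurableT_comp mg measurable_centered_square.
Qed.

Lemma is_derive_monomial (c x : R) k :
  is_derive x 1 (fun z : R => c / k.+1%:R * z ^+ k.+1) (c * x ^+ k).
Proof.
have DX : is_derive x 1 (fun z : R => z ^+ k.+1) (k.+1%:R * x ^+ k).
  elim: k => [|k IH]; first by rewrite mul1r expr0; exact: is_derive_id.
  rewrite (_ : (fun z : R => _) = (fun z => z * z ^+ k.+1)); last first.
    by apply/funext => z; rewrite exprS.
  apply: trigger_derive (is_derive_mul (is_derive_id x 1) IH) _.
  by rewrite mul1r mulrCA -exprS -[in RHS]natr1 mulrDl mul1r addrC.
apply: trigger_derive (is_derive_mul (is_derive_cst (c / k.+1%:R : R) x 1) DX) _.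
by rewrite /cst mul0r add0r mulrA divfK ?pnatr_eq0.
Qed.

(** The odd powers cancel by symmetry. *)
Lemma integral_uniform11_poly (c0 c1 c2 c3 c4 : R) :
  (forall b, 0 <= c0 + c1 * b + c2 * b ^+ 2 + c3 * b ^+ 3 + c4 * b ^+ 4) ->
  (\int[U]_b (c0 + c1 * b + c2 * b ^+ 2 + c3 * b ^+ 3 + c4 * b ^+ 4)%:E =
    (c0 + c2 / 3 + c4 / 5)%:E)%E.
Proof.
move=> p0; pose p b : R := c0 * b ^+ 0 + c1 * b ^+ 1 + c2 * b ^+ 2 + c3 * b ^+ 3 + c4 * b ^+ 4.
have pE (b : R) : c0 + c1 * b + c2 * b ^+ 2 + c3 * b ^+ 3 + c4 * b ^+ 4 = p b.
  by rewrite /p expr0 expr1 mulr1.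
pose F k c (z : R) := c / k.+1%:R * z ^+ k.+1.
pose G (z : R) := F 0%N c0 z + F 1%N c1 z + F 2 c2 z + F 3 c3 z + F 4 c4 z.
have dG (z : R) : is_derive z 1 G (p z).
  exact: is_deriveD (is_deriveD (is_deriveD (is_deriveD (is_derive_monomial _ _ _)
    (is_derive_monomial _ _ _)) (is_derive_monomial _ _ _))
    (is_derive_monomial _ _ _)) (is_derive_monomial _ _ _).
have cG : continuous G.
  move=> z; apply: differentiable_continuous; apply/derivable1_diffP.
  by case: (dG z).
have cp : continuous p.
  have cm (a : R) k : continuous (fun z : R => a * z ^+ k).
    by move=> z; apply: cvgM; [exact: cvg_cst|exact: exprn_continuous].
  move=> z; exact: cvgD (cvgD (cvgD (cvgD (cm _ _ z) (cm _ _ z)) (cm _ _ z)) (cm _ _ z)) (cm _ _ z).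
under eq_integral do rewrite pE.
rewrite integral_uniform; last 2 first.
- by apply/measurable_EFinP; exact: continuous_measurable_fun.
- by move=> b; rewrite lee_fin -pE.
rewrite (@continuous_FTC2 _ p G) ?ltN11//; last 3 first.
- exact: continuous_subspaceT.
- split; first by move=> z _; case: (dG z).
    exact/cvg_at_right_filter/cG.
  exact/cvg_at_left_filter/cG.
- by move=> z _; rewrite derive1E derive_val.
by rewrite -EFinB -EFinM /G /F; congr EFin; field.
Qed.

Lemma integral_uniform11_le (f : R -> \bar R) (M : R) : nonneg_measurable f ->
  (forall b, -1 <= b <= 1 -> (f b <= M%:E)%E) -> (\int[U]_b f b <= M%:E)%E.
Proof.
move=> [mf f0] fM; rewrite integral_uniform//.
apply: (@le_trans _ _ ((1 - -1)^-1%:E * \int[lebesgue_measure]_(x in `[-1, 1]%classic%R) (M%:E))%E).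
  apply: lee_wpmul2l; first by rewrite lee_fin opprK invr_ge0.
  apply: ge0_le_integral => //.
    exact: measurable_funTS.
rewrite integral_cst//= lebesgue_measure_itv/= lte_fin ltN11 -EFinB -!EFinM lee_fin.
by rewrite le_eqVlt; apply/orP; left; apply/eqP; field.
Qed.

Let integral_square_dist : (\int[U \x U]_p ((p.1 - p.2) ^+ 2)%:E = (2 / 3)%:E)%E.
Proof.
have inner (a : R) : (\int[U]_b ((a - b) ^+ 2)%:E = (a ^+ 2 + 1 / 3)%:E)%E.
  have E b : (a - b) ^+ 2 = a ^+ 2 + (- 2 * a) * b + 1 * b ^+ 2 + 0 * b ^+ 3 + 0 * b ^+ 4.
    by ring.
  under eq_integral do rewrite E.
  rewrite integral_uniform11_poly; first by congr EFin; field.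
  by move=> b; rewrite -E sqr_ge0.
rewrite fubini_tonelli1//=; last 2 first.
- apply/measurable_EFinP; apply: measurable_funX; exact: measurable_funB.
- by move=> p; rewrite lee_fin sqr_ge0.
rewrite /fubini_F /=; under eq_integral do rewrite inner.
have E (a : R) : a ^+ 2 + 1 / 3 = 1 / 3 + 0 * a + 1 * a ^+ 2 + 0 * a ^+ 3 + 0 * a ^+ 4.
  by ring.
under eq_integral do rewrite E.
rewrite integral_uniform11_poly; first by congr EFin; field.
by move=> a; rewrite -E addr_ge0// sqr_ge0.
Qed.

Lemma centered_square_variance : (\int[centered_square_law]_z (z ^+ 2)%:E = (28 / 45)%:E)%E.
Proof.
rewrite integral_centered_square_law; last first.
  split; last by move=> z; rewrite lee_fin sqr_ge0.
  by apply/measurable_EFinP; exact: measurable_funX.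
have inner (a : R) : (\int[U]_b (centered_square (a, b) ^+ 2)%:E =
    (a ^+ 4 + 2 / 3 * a ^+ 2 + 1 / 5)%:E)%E.
  have E (b : R) : centered_square (a, b) ^+ 2 = (a ^+ 2 - 2 / 3) ^+ 2 +
      (- 4 * a * (a ^+ 2 - 2 / 3)) * b + (6 * a ^+ 2 - 4 / 3) * b ^+ 2 +
      (- 4 * a) * b ^+ 3 + 1 * b ^+ 4.
    by rewrite /centered_square /=; field.
  under eq_integral do rewrite E.
  rewrite integral_uniform11_poly; first by congr EFin; field.
  by move=> b; rewrite -E sqr_ge0.
under eq_integral do rewrite inner.
have E (a : R) : a ^+ 4 + 2 / 3 * a ^+ 2 + 1 / 5 =
    1 / 5 + 0 * a + 2 / 3 * a ^+ 2 + 0 * a ^+ 3 + 1 * a ^+ 4.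
  by ring.
under eq_integral do rewrite E.
rewrite integral_uniform11_poly; first by congr EFin; field.
by move=> a; have := sqr_ge0 a; have := sqr_ge0 (a ^+ 2); rewrite -E; lra.
Qed.

(** On the support of the law, |(a - b)^2 - 2/3| <= 4. *)
Lemma centered_square_moment3 : centered_square_law.-integrable setT (fun z => (`|z| ^+ 3)%:E).
Proof.
have mcube : measurable_fun [set: measurableTypeR R] (fun z : R => `|z| ^+ 3).
  by apply: measurable_funX; exact: measurable_realfun.normr_measurable.
have nm : nonneg_measurable (fun z : R => (`|z| ^+ 3)%:E).
  by split; [exact/measurable_EFinP|move=> z; rewrite lee_fin exprn_ge0].
apply/integrableP; split; first exact/measurable_EFinP.
under eq_integral do rewrite /= ger0_norm ?exprn_ge0//.
rewrite integral_centered_square_law//; apply: (@le_lt_trans _ _ (4 ^+ 3)%:E); last by rewrite ltry.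
have mf : measurable_fun setT (fun p => (`|centered_square p| ^+ 3)%:E).
  exact: measurableT_comp nm.1 measurable_centered_square.
have f0 p : (0 <= (`|centered_square p| ^+ 3)%:E)%E by rewrite lee_fin exprn_ge0.
apply: integral_uniform11_le => [|a a1].
  split; first exact: (@measurable_fun_fubini_tonelli_F _ _ _ _ R U _ mf f0).
  by move=> a; exact: integral_ge0.
apply: integral_uniform11_le => [|b b1].
  split=> //; exact: measurableT_comp mf (measurable_pair1 a).
rewrite lee_fin lerXn2r ?nnegrE// /centered_square /= ler_norml.
have := sqr_ge0 (a - b); have : `|a - b| <= 2.
  by rewrite ler_norml; lra.
rewrite -(@ler_pXn2r _ 2) ?nnegrE// real_normK ?num_real// => ? ?.
by apply/andP; split; lra.
Qed.

(** The integrand changes sign, hence the detour through the nonnegative function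
(a - b)^2, whose integral is [integral_square_dist]. *)
Lemma centered_square_mean : (\int[centered_square_law]_z z%:E = 0)%E.
Proof.
have isq : (U \x U)%E.-integrable setT (fun p => ((p.1 - p.2) ^+ 2)%:E).
  apply/integrableP; split.
    by apply/measurable_EFinP; apply: measurable_funX; exact: measurable_funB.
  under eq_integral do rewrite /= ger0_norm ?sqr_ge0//.
  by rewrite integral_square_dist ltry.
pose UU : probability _ R := (U \x U)%E.
have icst : (U \x U)%E.-integrable setT (EFin \o cst (2 / 3 : R)).
  exact: (@finite_measure_integrable_cst _ _ _ UU setT (2 / 3) measurableT).
have csE : EFin \o centered_square =
    ((fun p => ((p.1 - p.2) ^+ 2)%:E) \- (EFin \o cst (2 / 3)%R))%E.
  by apply/funext.
rewrite integral_distribution//; last by rewrite csE; exact: integrableB.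
have Ecst : (\int[U \x U]_p (2 / 3)%:E = (2 / 3)%:E)%E.
  rewrite integral_cst// [X in (_ * X)%E](@probability_setT _ _ _ UU).
  by rewrite mule1.
rewrite csE integralB// integral_square_dist [X in (_ - X)%E]Ecst.
by rewrite -EFinB subrr.
Qed.

Lemma integral_cube_probS n (f : 'rV[R]_n.+1 -> \bar R) :
  measurable_fun setT f -> (forall x, 0 <= f x)%E ->
  (\int[Q n.+1]_p f p = \int[Q n]_x \int[U]_a f (cons_rV (a, x)))%E.
Proof.
move=> mf f0; rewrite /= ge0_integral_distribution//.
rewrite fubini_tonelli2//=.
apply: measurableT_comp mf _; exact: measurable_cons_rV.
Qed.

(** The squared distance is a sum of independent copies of (a - b)^2. By
induction on the dimension: the first coordinates a and b of the two points are
integrated last, once the integral over a has been exchanged with the one over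
the remaining coordinates of the second point. *)
Lemma sqdist_law n (g : R -> \bar R) t : nonneg_measurable g ->
  (\int[Q n]_x \int[Q n]_y g (t + (sqdist x y - n%:R * (2 / 3)))%R =
    iter n (shift_average centered_square_law) g t)%E.
Proof.
elim: n g t => [|n IH] g t gnm.
  have sq0 (x y : 'rV[R]_0) : t + (sqdist x y - 0%:R * (2 / 3)) = t.
    by rewrite /sqdist big_ord0 mul0r subr0 addr0.
  under eq_integral => x _ do under eq_integral => y _ do rewrite sq0.
  by rewrite /= !integral_dirac// !diracT !mul1e.
have [mg g0] := gnm.
pose G (p q : 'rV[R]_n.+1) := g (t + (sqdist p q - n.+1%:R * (2 / 3))).
have mG : measurable_fun setT (fun pq => G pq.1 pq.2).
  apply: measurableT_comp mg _; apply: measurable_funD => //.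
  by apply: measurable_funB => //; exact: measurable_sqdist.
have mG1 p : measurable_fun setT (G p).
  exact: measurableT_comp mG (measurable_pair1 p).
have G0 p q : (0 <= G p q)%E by exact: g0.
rewrite integral_cube_probS; last 2 first.
- exact: (@measurable_fun_fubini_tonelli_F _ _ _ _ R (Q n.+1) (fun pq => G pq.1 pq.2)).
- by move=> p; exact: integral_ge0.
transitivity (\int[Q n]_x \int[Q n]_y shift_average centered_square_law g (t + (sqdist x y - n%:R * (2 / 3)))%R)%E;
  last by rewrite IH ?iterSr//; exact: shift_average_nonneg_measurable.
apply: eq_integral => x _.
under eq_integral do rewrite (integral_cube_probS (mG1 _) (G0 _)).
pose H (ay : measurableTypeR R * 'rV[R]_n) :=
  (\int[U]_b G (cons_rV (ay.1, x)) (cons_rV (b, ay.2)))%E.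
have mH : measurable_fun setT H.
  pose K (q : (measurableTypeR R * 'rV[R]_n) * measurableTypeR R) :=
    G (cons_rV (q.1.1, x)) (cons_rV (q.2, q.1.2)).
  apply: (@measurable_fun_fubini_tonelli_F _ _ _ _ R U K); last by move=> q; exact: G0.
  pose h1 (q : (measurableTypeR R * 'rV[R]_n) * measurableTypeR R) := (q.1.1, x).
  pose h2 (q : (measurableTypeR R * 'rV[R]_n) * measurableTypeR R) := (q.2, q.1.2).
  have mh1 : measurable_fun setT h1.
    apply/measurable_fun_pairP; split; last exact: measurable_cst.
    exact: measurableT_comp measurable_fst measurable_fst.
  have mh2 : measurable_fun setT h2.
    apply/measurable_fun_pairP; split; first exact: measurable_snd.
    exact: measurableT_comp measurable_snd measurable_fst.
  have mh : measurable_fun setT (fun q => (cons_rV (h1 q), cons_rV (h2 q))).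
    apply/measurable_fun_pairP; split.
      exact: measurableT_comp (@measurable_cons_rV R n) mh1.
    exact: measurableT_comp (@measurable_cons_rV R n) mh2.
  exact: measurableT_comp mG mh.
have H0 ay : (0 <= H ay)%E by exact: integral_ge0.
transitivity (\int[U]_a \int[Q n]_y H (a, y))%E; first by [].
apply: etrans (@fubini_tonelli _ _ _ _ R U (Q n) H mH H0) _.
apply: eq_integral => y _; rewrite /H /= /shift_average integral_centered_square_law; last first.
  by split=> [|z]; [apply: measurableT_comp mg _; exact: measurable_funD|exact: g0].
apply: eq_integral => a _; apply: eq_integral => b _.
rewrite /G sqdist_cons /centered_square /=; congr g.
by rewrite -natr1; ring.
Qed.

End squared_distance.

(** * Joint laws and perturbations in probability *)

Section joint_law.
Variables (R : realType) (d1 d2 : measure_display).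
Variables (T1 : measurableType d1) (T2 : measurableType d2).

(** Both joint laws are the product of the marginal ones, and the product measure
is characterised by its values on rectangles. *)
Lemma independent_joint_law (d d' : measure_display) (T : measurableType d)
    (T' : measurableType d') (P : probability T R) (P' : probability T' R)
    (X : {RV P >-> T1}) (Y : {RV P >-> T2}) (X' : {RV P' >-> T1}) (Y' : {RV P' >-> T2}) :
  independent_RV X Y -> independent_RV X' Y' ->
  (forall A, measurable A -> distribution P X A = distribution P' X' A) ->
  (forall A, measurable A -> distribution P Y A = distribution P' Y' A) ->
  forall B : set (T1 * T2), measurable B ->
    P [set w | B (X w, Y w)] = P' [set w | B (X' w, Y' w)].
Proof.
move=> indep indep' lawX lawY B mB.
have product_law (d0 : measure_display) (T0 : measurableType d0) (P0 : probability T0 R)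
    (X0 : {RV P0 >-> T1}) (Y0 : {RV P0 >-> T2}) : independent_RV X0 Y0 ->
    (forall A, measurable A -> distribution P X A = distribution P0 X0 A) ->
    (forall A, measurable A -> distribution P Y A = distribution P0 Y0 A) ->
    P0 [set w | B (X0 w, Y0 w)] = (distribution P X \x distribution P Y)%E B.
  move=> indep0 lawX0 lawY0.
  pose XY w := (X0 w, Y0 w).
  have mXY : measurable_fun setT XY by apply/measurable_fun_pairP; split.
  pose XYmix := isMeasurableFun.Build _ _ _ _ XY mXY.
  pose XYf : {RV P0 >-> (T1 * T2)%type} := HB.pack XY XYmix.
  rewrite (@product_measure_unique _ _ _ _ _ _ _ (distribution P0 XYf))//.
  move=> C D mC mD; apply: etrans (indep0 C D mC mD) _.
  by congr (_ * _)%E; [exact/esym/lawX0|exact/esym/lawY0].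
by rewrite (product_law _ _ P X Y)// (product_law _ _ P' X' Y').
Qed.

End joint_law.

Section slutsky.
Variable R : realType.

(** Convergence of distribution functions to a continuous limit survives a
perturbation that tends to 0 in probability: up to a small probability, the
events W' <= c and W <= c can be compared after moving c by delta. *)
Lemma slutsky (d : nat -> measure_display) (T : forall n, measurableType (d n))
    (P : forall n, probability (T n) R) (W W' : forall n, T n -> R) (F : R -> R) :
  (forall n, measurable_fun setT (W n)) -> (forall n, measurable_fun setT (W' n)) ->
  continuous F ->
  (forall c y, c n @[n --> \oo] --> y ->
     P n [set w | W n w <= c n] @[n --> \oo] --> (F y)%:E) ->
  (forall delta, 0 < delta ->
     P n [set w | delta < `|W' n w - W n w| ] @[n --> \oo] --> 0%E) ->
  forall c y, c n @[n --> \oo] --> y ->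
     P n [set w | W' n w <= c n] @[n --> \oo] --> (F y)%:E.
Proof.
move=> mW mW' cF cvgW diff0 c y cy; apply: cvg_EFin_sandwich => eta eta0.
have eta2 : 0 < eta / 2 by rewrite divr_gt0.
have [delta delta0 [Fup Flow]] : exists2 delta : R, 0 < delta &
    F (y + delta) <= F y + eta / 4 /\ F y - eta / 4 <= F (y - delta).
  have eta4 : 0 < eta / 4 by rewrite divr_gt0.
  have /cvgrPdist_le /(_ _ eta4) /nbhs_ballP[e /= e0 He] := cF y.
  exists (e / 2); first by rewrite divr_gt0.
  have e2 : 0 < e / 2 by rewrite divr_gt0.
  have : `|F y - F (y + e / 2)| <= eta / 4.
    apply: He; rewrite /ball /= opprD addrA subrr sub0r normrN gtr0_norm//.
    by rewrite ltr_pdivrMr// ltr_pMr// ltr1n.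
  have : `|F y - F (y - e / 2)| <= eta / 4.
    apply: He; rewrite /ball /= opprB addrCA subrr addr0 gtr0_norm//.
    by rewrite ltr_pdivrMr// ltr_pMr// ltr1n.
  rewrite !ler_norml => /andP[_ H1] /andP[H2 _]; split; lra.
have eta4 : 0 < eta / 4 by rewrite divr_gt0.
have /fine_cvgP[fin1 /cvgrPdist_le /(_ _ eta4) near1] :
    P n [set w | W n w <= c n + delta] @[n --> \oo] --> (F (y + delta))%:E.
  by apply: cvgW; apply: cvgD => //; exact: cvg_cst.
have /fine_cvgP[fin2 /cvgrPdist_le /(_ _ eta4) near2] :
    P n [set w | W n w <= c n - delta] @[n --> \oo] --> (F (y - delta))%:E.
  by apply: cvgW; apply: cvgB => //; exact: cvg_cst.
have /fine_cvgP[fin3 /cvgrPdist_le /(_ _ eta2) near3] := diff0 _ delta0.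
have mle n (V : T n -> R) a : measurable_fun setT V -> measurable [set w | V w <= a].
  move=> mV; rewrite -[X in measurable X]setTI.
  rewrite (_ : [set w | _] = V @^-1` `]-oo, a]%classic); first exact: mV.
  by apply/seteqP; split => w /=; rewrite in_itv.
near=> n.
have mdiff : measurable [set w | delta < `|W' n w - W n w| ].
  rewrite -[X in measurable X]setTI.
  rewrite (_ : [set w | _] = (fun w => `|W' n w - W n w|) @^-1` `]delta, +oo[%classic).
    apply: (measurableT_comp (@measurable_realfun.normr_measurable R setT)) => //.
    exact: measurable_funB.
  by apply/seteqP; split => w /=; rewrite in_itv /= andbT.
have D : (P n [set w | (delta < `|W' n w - W n w|)%R ] <= (eta / 2)%:E)%E.
  have : `|0 - fine (P n [set w | delta < `|W' n w - W n w| ])| <= eta / 2.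
    by near: n; exact: near3.
  rewrite sub0r normrN ger0_norm ?fine_ge0//.
  by rewrite -lee_fin fineK//; near: n; exact: fin3.
have U : (P n [set w | (W n w <= c n + delta)%R ] <= (F y + eta / 2)%:E)%E.
  have f1 : P n [set w | W n w <= c n + delta] \is a fin_num by near: n; exact: fin1.
  have : `|F (y + delta) - fine (P n [set w | W n w <= c n + delta])| <= eta / 4.
    by near: n; exact: near1.
  by rewrite ler_norml => /andP[H _]; rewrite -(fineK f1) lee_fin; lra.
have L : ((F y - eta / 2)%:E <= P n [set w | (W n w <= c n - delta)%R ])%E.
  have f2 : P n [set w | W n w <= c n - delta] \is a fin_num by near: n; exact: fin2.
  have : `|F (y - delta) - fine (P n [set w | W n w <= c n - delta])| <= eta / 4.
    by near: n; exact: near2.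
  by rewrite ler_norml => /andP[_ H]; rewrite -(fineK f2) lee_fin; lra.
have union_bound (A B : set (T n)) : measurable A -> measurable B ->
    A `<=` B `|` [set w | delta < `|W' n w - W n w| ] -> (P n A <= P n B + (eta / 2)%:E)%E.
  move=> mA mB AB; apply: le_trans (leeD2l _ D).
  apply: (@le_trans _ _ (P n (B `|` [set w | delta < `|W' n w - W n w| ]))).
    by apply: le_measure; rewrite ?inE//; exact: measurableU.
  exact: measureU2.
split.
- have : ((F y - eta / 2)%:E <= P n [set w | (W' n w <= c n)%R ] + (eta / 2)%:E)%E.
    apply: le_trans L _; apply: union_bound; [exact: mle|exact: mle|move=> w /= Wc].
    have [|far] := leP (`|W' n w - W n w|) delta; last by right.
    by rewrite ler_norml => /andP[_ ?]; left; lra.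
  rewrite -leeBlDr// -EFinB; apply: le_trans; rewrite lee_fin; lra.
- have := leeD2r (eta / 2)%:E U; rewrite -EFinD => UU.
  apply: le_trans (le_trans _ UU) _; last by rewrite lee_fin; lra.
  apply: union_bound; [exact: mle|exact: mle|move=> w /= Wc].
  have [|far] := leP (`|W' n w - W n w|) delta; last by right.
  by rewrite ler_norml => /andP[? _]; left; lra.
Unshelve. all: by end_near. Qed.

End slutsky.

(** * Convergence of the distance *)

Section distance.
Variable R : realType.
Local Notation Q := (cube_prob R).
Local Notation Phi := (@Gcdf R).
Local Notation sigma2 := (28 / 45 : R).

Definition cube_pair n : probability ('rV[R]_n * 'rV[R]_n)%type R :=
  (Q n \x Q n)%E.

Definition deviation n (xy : 'rV[R]_n * 'rV[R]_n) : R :=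
  (sqdist xy.1 xy.2 - n%:R * (2 / 3)) / Num.sqrt n%:R.

Definition normalize_pair n (xy : 'rV[R]_n * 'rV[R]_n) := (normalize xy.1, normalize xy.2).

Lemma measurable_deviation n : measurable_fun setT (@deviation n).
Proof.
by apply: measurable_funM => //; apply: measurable_funB => //; exact: measurable_sqdist.
Qed.

Lemma measurable_normalize_pair n : measurable_fun setT (@normalize_pair n).
Proof.
apply/measurable_fun_pairP; split.
  exact: measurableT_comp (@measurable_normalize R n) measurable_fst.
exact: measurableT_comp (@measurable_normalize R n) measurable_snd.
Qed.

(** The probability is an integral of an indicator over pairs of points, which
[sqdist_law] turns into the iterated averages of the central limit theorem. *)
Lemma deviation_cvg (c : R^nat) (y : R) : c n @[n --> \oo] --> y ->
  cube_pair n [set xy | deviation xy <= c n] @[n --> \oo] -->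
    (Phi (y / Num.sqrt sigma2))%:E.
Proof.
move=> cy; have s0 : 0 < sigma2 by [].
have := central_limit s0 (centered_square_mean R) (centered_square_variance R) (centered_square_moment3 R) cy.
apply: cvg_trans; apply: near_eq_cvg; near=> n.
have r0 : 0 < Num.sqrt n%:R :> R.
  by rewrite sqrtr_gt0 ltr0n; near: n; exact: nbhs_infty_gt.
set g := fun t : R => _.
have gnm : nonneg_measurable g.
  by split=> [|t]; [exact/measurable_EFinP/measurable_indic|rewrite lee_fin].
rewrite -sqdist_law//.
pose A := [set xy : 'rV[R]_n * 'rV[R]_n | deviation xy <= c n].
have mA : measurable A.
  rewrite -[X in measurable X]setTI.
  rewrite (_ : A = (@deviation n) @^-1` `]-oo, c n]%classic).
    exact: measurable_deviation.
  by apply/seteqP; split => w /=; rewrite /A /= in_itv.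
transitivity (\int[Q n]_x Q n (xsection A x))%E; last by [].
apply: eq_integral => x _.
rewrite -(setIT (xsection A x)) -integral_indic//; last exact: measurable_xsection.
apply: eq_integral => y' _; rewrite /g add0r; congr EFin.
rewrite !indicE mem_xsection; congr (_%:R); congr nat_of_bool; apply/idP/idP.
  by rewrite [X in X -> _]inE /= in_itv /= => ?; rewrite inE /A /= /deviation ler_pdivrMr.
by rewrite inE /A /= /deviation ler_pdivrMr// => ?; rewrite inE /= in_itv.
Unshelve. all: by end_near. Qed.

Lemma normalize_coord n (x : 'rV[R]_n) i : `|x| <= 1 ->
  `|normalize x ord0 i| <= 1 /\ `|normalize x ord0 i - x ord0 i| <= 1 - `|x|.
Proof.
move=> x1; have xi : `|x ord0 i| <= `|x| by move: i; apply/(rV_norm_le _ (normr_ge0 x)).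
rewrite mxE; have [x0|x0] := eqVneq (`|x|) 0.
  have -> : x ord0 i = 0 by apply/eqP; rewrite -normr_le0 -x0.
  by rewrite mulr0 subr0 normr0 x0 subr0.
have px : 0 < `|x| by rewrite lt_neqAle eq_sym x0 normr_ge0.
have inv1 : 1 <= `|x|^-1 by rewrite invf_ge1.
split.
  by rewrite normrM ger0_norm ?invr_ge0// ler_pdivrMl// mulr1.
rewrite -[X in _ - X]mul1r -mulrBl normrM ger0_norm ?subr_ge0//.
apply: (@le_trans _ _ ((`|x|^-1 - 1) * `|x|)); first by rewrite ler_wpM2l ?subr_ge0.
by rewrite mulrBl mulVf// mul1r.
Qed.

(** Normalising moves no coordinate by more than 1 - |x|, and the sum of two
differences of coordinates is at most 4. *)
Lemma sqdist_normalize n (x y : 'rV[R]_n) : `|x| <= 1 -> `|y| <= 1 ->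
  `|sqdist (normalize x) (normalize y) - sqdist x y|
    <= n%:R * (4 * ((1 - `|x|) + (1 - `|y|))).
Proof.
move=> x1 y1; rewrite /sqdist -sumrB.
apply: le_trans (ler_norm_sum _ _ _) _.
rewrite mulr_natl -[X in _ <= _ *+ X]card_ord -sumr_const; apply: ler_sum => i _.
have [nx dx] := normalize_coord i x1; have [ny dy] := normalize_coord i y1.
have xi : `|x ord0 i| <= 1 by move/(rV_norm_le _ ler01): x1.
have yi : `|y ord0 i| <= 1 by move/(rV_norm_le _ ler01): y1.
move: nx dx ny dy xi yi; set u' := normalize x _ _; set v' := normalize y _ _.
move: (x _ _) (y _ _) => u v; rewrite subr_sqr normrM mulrC => nx dx ny dy xi yi.
apply: ler_pM => //.
  apply: le_trans (ler_normD _ _) _.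
  by apply: le_trans (lerD (ler_normB _ _) (ler_normB _ _)) _; lra.
rewrite (_ : _ - _ - _ = (u' - u) - (v' - v)); last by ring.
by apply: le_trans (ler_normB _ _) _; lra.
Qed.

Lemma bernoulli_bound (s : R) n : 0 <= s <= 1 -> (1 - s) ^+ n * (1 + n%:R * s) <= 1.
Proof.
move=> /andP[s0 s1]; elim: n => [|n IH]; first by rewrite mul0r addr0 mulr1.
apply: le_trans IH; rewrite exprSr -mulrA ler_wpM2l ?exprn_ge0 ?subr_ge0//.
have n0 : 0 <= n%:R * s * s by rewrite !mulr_ge0.
by rewrite -natr1; have := sqr_ge0 s; nra.
Qed.

(** The points at which normalisation may be more than a perturbation of size s;
the outside of the cube, a null set, is included. *)
Definition off_boundary n (s : R) : set 'rV[R]_n := ~` box 1 `|` box (1 - s).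

Lemma measurable_off_boundary n s : measurable (@off_boundary n s).
Proof. by apply: measurableU; [apply: measurableC|]; exact: measurable_box. Qed.

(** The largest coordinate of a point of the cube is within s of 1 unless all
coordinates are at most 1 - s, which has probability (1 - s)^n. *)
Lemma cube_prob_off_boundary n s : 0 < s -> (0 < n)%N ->
  (Q n (off_boundary s) <= (n%:R * s)^-1%:E)%E.
Proof.
move=> s0 n0; have ns0 : 0 < n%:R * s by rewrite mulr_gt0 ?ltr0n.
apply: (@le_trans _ _ (Q n (~` box 1) + Q n (box (1 - s)))%E).
  by apply: measureU2; [apply: measurableC|]; exact: measurable_box.
rewrite probability_setC; last exact: measurable_box.
rewrite cube_prob_box ?ler01 ?lexx// expr1n subee// add0e.
have [s1|s1] := leP s 1.
  rewrite cube_prob_box ?subr_ge0 ?s1 ?gerBl ?(ltW s0)// lee_fin.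
  rewrite -[leRHS]mul1r ler_pdivlMr//.
  apply: le_trans (_ : (1 - s) ^+ n * (1 + n%:R * s) <= 1).
    by rewrite ler_wpM2l ?exprn_ge0 ?subr_ge0// lerDr.
  by apply: bernoulli_bound; rewrite s1 ltW.
rewrite (_ : box _ = set0) ?measure0 ?lee_fin ?invr_ge0 ?ltW//.
apply/seteqP; split => x //; rewrite /box /= => /(le_trans (normr_ge0 _)).
by rewrite subr_ge0 leNgt s1.
Qed.

(** On the event that neither point is off the boundary by s, the deviations
differ by at most 4 sqrt n * 2 s, which is delta for s = delta / (8 sqrt n);
each of the two exceptional events has probability at most
1 / (n s) = 8 / (delta sqrt n). *)
Lemma normalize_pair_far n delta : 0 < delta -> (0 < n)%N ->
  (cube_pair n [set xy | (delta < `|deviation (normalize_pair xy) - deviation xy|)%R ]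
    <= (16 / delta / Num.sqrt n%:R)%:E)%E.
Proof.
move=> delta0 n0; pose r : R := Num.sqrt n%:R.
have n0' : 0 < n%:R :> R by rewrite ltr0n.
have r0 : 0 < r by rewrite sqrtr_gt0.
have rr : r ^+ 2 = n%:R by rewrite sqr_sqrtr// ltW.
pose s := delta / (8 * r).
have s0 : 0 < s by rewrite divr_gt0// mulr_gt0.
have mo := @measurable_off_boundary n s.
set far := [set xy | _].
have mfar : measurable far.
  rewrite -[X in measurable X]setTI.
  rewrite (_ : far = (fun xy => `|deviation (normalize_pair xy) - deviation xy|)
    @^-1` `]delta, +oo[%classic).
    apply: (measurableT_comp (@measurable_realfun.normr_measurable R setT)) => //.
    apply: measurable_funB; last exact: measurable_deviation.
    exact: measurableT_comp (@measurable_deviation n) (@measurable_normalize_pair n).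
  by apply/seteqP; split => w /=; rewrite in_itv /= andbT.
apply: (@le_trans _ _ (cube_pair n ((off_boundary s `*` setT) `|` (setT `*` off_boundary s)))).
  apply: le_measure; rewrite ?inE//.
    by apply: measurableU; exact: measurableX.
  move=> [x y]; apply: contraPP => /not_orP[nx ny].
  have good (z : 'rV[R]_n) : ~ off_boundary s z -> `|z| <= 1 /\ 1 - `|z| < s.
    move=> /not_orP[/contrapT z1 /negP]; rewrite -ltNge => z2; split => //.
    by rewrite ltrBlDr -ltrBlDl.
  have [x1 xs] : `|x| <= 1 /\ 1 - `|x| < s by apply: good => ?; exact: nx.
  have [y1 ys] : `|y| <= 1 /\ 1 - `|y| < s by apply: good => ?; exact: ny.
  apply/negP; rewrite -leNgt /deviation /= -mulrBl opprB addrA subrK.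
  rewrite normrM [`|_^-1|]ger0_norm ?invr_ge0// ler_pdivrMr//.
  apply: le_trans (sqdist_normalize x1 y1) _.
  have -> : delta * Num.sqrt n%:R = n%:R * (4 * (s + s)).
    by rewrite -/r -rr /s; field; rewrite gt_eqF.
  by rewrite ler_pM2l// ler_pM2l// lerD// ltW.
apply: le_trans (measureU2 _ _ _) _; [exact: measurableX|exact: measurableX|].
have pairE (A B : set 'rV[R]_n) : measurable A -> measurable B ->
    cube_pair n (A `*` B) = (Q n A * Q n B)%E.
  by move=> mA mB; exact: product_measure1E.
rewrite [X in (X + _ <= _)%E]pairE// [X in (_ + X <= _)%E]pairE//.
have Q1 : Q n setT = 1%E by exact: probability_setT.
rewrite Q1 mule1 mul1e.
have -> : 16 / delta / r = (n%:R * s)^-1 + (n%:R * s)^-1.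
  by rewrite -rr /s; field; rewrite !gt_eqF.
by rewrite EFinD; apply: leeD; exact: cube_prob_off_boundary.
Qed.

Lemma deviation_normalize_cvg (c : R^nat) (y : R) : c n @[n --> \oo] --> y ->
  cube_pair n [set xy | deviation (normalize_pair xy) <= c n] @[n --> \oo] -->
    (Phi (y / Num.sqrt sigma2))%:E.
Proof.
apply: (@slutsky _ _ _ cube_pair (@deviation) (fun n => @deviation n \o @normalize_pair n)
   (fun y => Phi (y / Num.sqrt sigma2))) => {c y}.
- exact: measurable_deviation.
- move=> n; exact: measurableT_comp (@measurable_deviation n) (@measurable_normalize_pair n).
- move=> y; apply: (@continuous_comp _ _ _ (fun y : R => y / Num.sqrt sigma2) Phi);
    last exact: continuous_Gcdf.
  by apply: cvgM; [exact: cvg_id|exact: cvg_cst].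
- exact: deviation_cvg.
- move=> delta delta0; apply: cvg_EFin_sandwich => eta eta0; near=> n; split.
    apply: le_trans (measure_ge0 _ _); rewrite lee_fin sub0r oppr_le0 ltW//.
  have n0 : (0 < n)%N by near: n; exact: nbhs_infty_gt.
  apply: le_trans (normalize_pair_far delta0 n0) _; rewrite add0r lee_fin.
  by near: n; exact: near_div_sqrt.
Unshelve. all: by end_near. Qed.

(** The delta method for the square root, in exact form: squaring the inequality
|x - y|_2 <= sqrt (2 n / 3) + a gives a threshold for the squared distance, with
an error term a^2 / sqrt n. *)
Lemma norm2_deviation n (x y : 'rV[R]_n) (a : R) : (0 < n)%N ->
  0 <= Num.sqrt (2 / 3) + a / Num.sqrt n%:R ->
  (Num.sqrt n%:R * ((Num.sqrt n%:R)^-1 * norm2 (x - y) - Num.sqrt (2 / 3)) <= a) =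
  (deviation (x, y) <= 2 * Num.sqrt (2 / 3) * a + a ^+ 2 / Num.sqrt n%:R).
Proof.
move=> n0; set r := Num.sqrt n%:R; set q := Num.sqrt (2 / 3) => tau0.
have n0' : 0 < n%:R :> R by rewrite ltr0n.
have r0 : 0 < r by rewrite sqrtr_gt0.
have rr : r ^+ 2 = n%:R by rewrite sqr_sqrtr// ltW.
have qq : q ^+ 2 = 2 / 3 by rewrite sqr_sqrtr// divr_ge0.
have -> : norm2 (x - y) = Num.sqrt (sqdist x y).
  by rewrite /norm2 /sqdist; congr Num.sqrt; apply: eq_bigr => i _; rewrite !mxE.
have S0 : 0 <= sqdist x y by apply: sumr_ge0 => i _; exact: sqr_ge0.
rewrite mulrBr mulrA divff ?gt_eqF// mul1r lerBlDr.
have -> : a + r * q = r * (q + a / r) by field; rewrite gt_eqF.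
have t0 : 0 <= r * (q + a / r) by rewrite mulr_ge0// ltW.
rewrite -(@ler_pXn2r _ 2) ?nnegrE ?sqrtr_ge0// sqr_sqrtr//.
rewrite /deviation /= -/r ler_pdivrMr// lerBlDr; congr (_ <= _).
rewrite -qq -rr; field; rewrite gt_eqF//.
Qed.

(** Rescaling by the factor 2 sqrt (2/3) of the delta method:
28/45 = 4 * (2/3) * (7/30). *)
Lemma variance_scale (a : R) :
  2 * Num.sqrt (2 / 3) * a / Num.sqrt sigma2 = a / Num.sqrt (7 / 30).
Proof.
have -> : Num.sqrt sigma2 = 2 * Num.sqrt (2 / 3) * Num.sqrt (7 / 30).
  rewrite -{1}(@ger0_norm R 2)// -sqrtr_sqr -!sqrtrM ?mulr_ge0 ?sqr_ge0 ?divr_ge0//.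
  by congr Num.sqrt; field.
have q0 : Num.sqrt (2 / 3 : R) != 0 by rewrite gt_eqF// sqrtr_gt0 divr_gt0.
have p0 : Num.sqrt (7 / 30 : R) != 0 by rewrite gt_eqF// sqrtr_gt0 divr_gt0.
by field; rewrite q0 p0.
Qed.

Lemma threshold_cvg (a : R) :
  2 * Num.sqrt (2 / 3) * a + a ^+ 2 / Num.sqrt n%:R @[n --> \oo] -->
    2 * Num.sqrt (2 / 3) * a.
Proof.
apply/cvgrPdist_le => eta eta0; near=> n.
rewrite opprD addrA subrr sub0r normrN ger0_norm ?divr_ge0 ?sqr_ge0//.
by near: n; exact: near_div_sqrt.
Unshelve. all: by end_near. Qed.

(** N is the identity for points uniform in the cube, and the radial projection
for points distributed by the cone measure. *)
Lemma deviation_joint_law (d : measure_display) (T : measurableType d)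
    (P : probability T R) n (X Y : {RV P >-> 'rV[R]_n})
    (N : 'rV[R]_n -> 'rV[R]_n) : measurable_fun setT N ->
  independent_RV X Y ->
  (forall A, measurable A -> distribution P X A = Q n (N @^-1` A)) ->
  (forall A, measurable A -> distribution P Y A = Q n (N @^-1` A)) ->
  forall c, P [set w | deviation (X w, Y w) <= c] =
    cube_pair n [set xy | deviation (N xy.1, N xy.2) <= c].
Proof.
move=> mN indep lawX lawY c.
pose N1 (xy : 'rV[R]_n * 'rV[R]_n) := N xy.1.
pose N2 (xy : 'rV[R]_n * 'rV[R]_n) := N xy.2.
have mN1 : measurable_fun setT N1 by exact: measurableT_comp mN measurable_fst.
have mN2 : measurable_fun setT N2 by exact: measurableT_comp mN measurable_snd.
pose N1mix := isMeasurableFun.Build _ _ _ _ N1 mN1.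
pose N2mix := isMeasurableFun.Build _ _ _ _ N2 mN2.
pose X' : {RV (cube_pair n) >-> 'rV[R]_n} := HB.pack N1 N1mix.
pose Y' : {RV (cube_pair n) >-> 'rV[R]_n} := HB.pack N2 N2mix.
have mpre A : measurable A -> measurable (N @^-1` A).
  by move=> mA; rewrite -[X in measurable X]setTI; exact: mN.
have QT : Q n setT = 1%E by exact: probability_setT.
have pairE (A B : set 'rV[R]_n) : measurable A -> measurable B ->
    cube_pair n (A `*` B) = (Q n A * Q n B)%E.
  by move=> mA mB; exact: product_measure1E.
have lawX' A : measurable A -> distribution (cube_pair n) X' A = Q n (N @^-1` A).
  move=> mA; transitivity (cube_pair n ((N @^-1` A) `*` setT)).
    by congr (cube_pair n _); apply/seteqP; split => -[x y] //= [].
  by rewrite pairE ?QT ?mule1//; exact: mpre.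
have lawY' A : measurable A -> distribution (cube_pair n) Y' A = Q n (N @^-1` A).
  move=> mA; transitivity (cube_pair n (setT `*` (N @^-1` A))).
    by congr (cube_pair n _); apply/seteqP; split => -[x y] //= [].
  by rewrite pairE ?QT ?mul1e//; exact: mpre.
have indep' : independent_RV X' Y'.
  move=> A B mA mB; rewrite -[cube_pair n (X' @^-1` A)]/(distribution _ X' A).
  rewrite -[cube_pair n (Y' @^-1` B)]/(distribution _ Y' B) lawX'// lawY'//.
  by rewrite -pairE//; exact: mpre.
apply: (independent_joint_law indep indep' _ _ (B := [set xy | deviation xy <= c])).
- by move=> A mA; rewrite lawX// -lawX'.
- by move=> A mA; rewrite lawY// -lawY'.
- rewrite -[X in measurable X]setTI.
  rewrite (_ : [set _ | _] = (@deviation n) @^-1` `]-oo, c]%classic).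
    exact: measurable_deviation.
  by apply/seteqP; split => w /=; rewrite in_itv.
Qed.

End distance.

Theorem theorem1p2 (R : realType) (d : nat -> measure_display)
  (T : forall n : nat, measurableType (d n))
  (P : forall n : nat, probability (T n) R)
  (X Y : forall n : nat, {RV P n >-> 'rV[R]_n})
  (indep : forall n : nat, (0 < n)%N -> independent_RV (X n) (Y n))
  (unif :
    (forall n : nat, (0 < n)%N ->
       uniform_on_cube_boundary (X n) /\ uniform_on_cube_boundary (Y n)) \/
    (forall n : nat, (0 < n)%N ->
       uniform_on_cube (X n) /\ uniform_on_cube (Y n))) :
  cvg_in_distribution P
    (fun n (w : T n) =>
       Num.sqrt n%:R *
       ((Num.sqrt n%:R)^-1 * norm2 (X n w - Y n w) - Num.sqrt (2 / 3)))
    (normal_prob 0 (Num.sqrt (7 / 30))).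
Proof.
move=> x _; rewrite normal_prob0E ?sqrtr_gt0 ?divr_gt0// -variance_scale.
pose c n := 2 * Num.sqrt (2 / 3) * x + x ^+ 2 / Num.sqrt n%:R.
have cx : c n @[n --> \oo] --> 2 * Num.sqrt (2 / 3) * x.
  exact: threshold_cvg.
have deviationE : \forall n \near \oo,
    P n [set w | deviation (X n w, Y n w) <= c n] = P n [set w | Num.sqrt n%:R *
      ((Num.sqrt n%:R)^-1 * norm2 (X n w - Y n w) - Num.sqrt (2 / 3)) <= x].
  near=> n; congr (P n _); apply/funext => w /=; congr is_true; apply/esym.
  apply: norm2_deviation; first by near: n; exact: nbhs_infty_gt.
  have : - x / Num.sqrt n%:R <= Num.sqrt (2 / 3).
    by near: n; apply: near_div_sqrt; rewrite sqrtr_gt0 divr_gt0.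
  by rewrite mulNr; lra.
apply: cvg_trans (near_eq_cvg deviationE) _.
case: unif => unif.
- apply: cvg_trans (deviation_normalize_cvg cx); apply: near_eq_cvg; near=> n.
  have n0 : (0 < n)%N by near: n; exact: nbhs_infty_gt.
  have [uX uY] := unif n n0; apply/esym.
  apply: (deviation_joint_law (@measurable_normalize R n) (indep n n0)) => A mA.
    by rewrite uX// cone_measureE.
  by rewrite uY// cone_measureE.
- apply: cvg_trans (deviation_cvg cx); apply: near_eq_cvg; near=> n.
  have n0 : (0 < n)%N by near: n; exact: nbhs_infty_gt.
  have [uX uY] := unif n n0; apply/esym.
  rewrite (deviation_joint_law (@measurable_id _ 'rV[R]_n setT) (indep n n0)).
  + by congr (cube_pair _ _ _); apply/seteqP; split => -[].
  + by move=> A mA; rewrite uX// cube_uniformE.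
  + by move=> A mA; rewrite uY// cube_uniformE.
Unshelve. all: by end_near. Qed.
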